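(* Let $(TM,\lambda)$ be an EAP-space. The curvature tensors of the natural metric $d$-connection $\mathring D$ can be expressed in the form (with $|$, $||$ the covariant derivatives of the canonical $d$-connection): (a) $\mathring R^\alpha_{\beta\mu\nu}=(\gamma^\alpha_{\beta\mu|\nu}-\gamma^\alpha_{\beta\nu|\mu})+(\gamma^\epsilon_{\beta\nu}\gamma^\alpha_{\epsilon\mu}-\gamma^\epsilon_{\beta\mu}\gamma^\alpha_{\epsilon\nu})-\gamma^\alpha_{\beta\epsilon}\Lambda^\epsilon_{\nu\mu}-\gamma^\alpha_{\beta d}R^d_{\nu\mu}$, (b) $\mathring R^a_{b\mu\nu}=(\gamma^a_{b\mu|\nu}-\gamma^a_{b\nu|\mu})+(\gamma^d_{b\nu}\gamma^a_{d\mu}-\gamma^d_{b\mu}\gamma^a_{d\nu})-\gamma^a_{b\epsilon}\Lambda^\epsilon_{\nu\mu}-\gamma^a_{bd}R^d_{\nu\mu}$, (c) $\mathring P^\alpha_{\beta\nu c}=(\gamma^\alpha_{\beta c|\nu}-\gamma^\alpha_{\beta\nu||c})+(\gamma^\epsilon_{\beta\nu}\gamma^\alpha_{\epsilon c}-\gamma^\epsilon_{\beta c}\gamma^\alpha_{\epsilon\nu})-\gamma^\alpha_{\beta\epsilon}C^\epsilon_{\nu c}-\gamma^\alpha_{\beta d}P^d_{\nu c}$, (d) $\mathring P^a_{b\nu c}=(\gamma^a_{bc|\nu}-\gamma^a_{b\nu||c})+(\gamma^d_{b\nu}\gamma^a_{dc}-\gamma^d_{bc}\gamma^a_{d\nu})-\gamma^a_{b\epsilon}C^\epsilon_{\nu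 c}-\gamma^a_{bd}P^d_{\nu c}$, (e) $\mathring S^\alpha_{\beta bc}=(\gamma^\alpha_{\beta b||c}-\gamma^\alpha_{\beta c||b})+(\gamma^\epsilon_{\beta c}\gamma^\alpha_{\epsilon b}-\gamma^\epsilon_{\beta b}\gamma^\alpha_{\epsilon c})-\gamma^\alpha_{\beta d}T^d_{cb}$, (f) $\mathring S^a_{bcd}=(\gamma^a_{bc||d}-\gamma^a_{bd||c})+(\gamma^e_{bd}\gamma^a_{ec}-\gamma^e_{bc}\gamma^a_{ed})-\gamma^a_{be}T^e_{dc}$. Consequently, (g) $\mathring R_{\beta\mu}:=\mathring R^\alpha_{\beta\mu\alpha}=(\gamma^\alpha_{\beta\mu|\alpha}-C_{\beta|\mu})-C_\epsilon\gamma^\epsilon_{\beta\mu}+\gamma^\alpha_{\beta\epsilon}\gamma^\epsilon_{\mu\alpha}-\gamma^\alpha_{\beta d}R^d_{\alpha\mu}$, (h) $\mathring{\mathcal R}:=g^{\beta\mu}\mathring R_{\beta\mu}=\frac12(\Omega^{\alpha\mu}{}_{\mu|\alpha}-C_\alpha\Omega^{\alpha\mu}{}_\mu)-C^\mu{}_{|\mu}+\gamma^{\alpha\mu}{}_\epsilon\gamma^\epsilon_{\mu\alpha}-\gamma^{\alpha\mu}{}_dR^d_{\alpha\mu}$, (i) $\mathring P_{\beta c}:=-\mathring P^\alpha_{\beta\alpha c}=(C_{\beta||c}-\gamma^\alpha_{\beta c|\alpha})+C_\epsilon\gamma^\epsilon_{\beta c}+\gamma^\alpha_{\beta\epsilon}(C^\epsilon_{\alpha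 c}-\gamma^\epsilon_{\alpha c})+\gamma^\alpha_{\beta d}P^d_{\alpha c}$, (j) $\mathring P_{b\nu}:=\mathring P^d_{b\nu d}=(C_{b|\nu}-\gamma^d_{b\nu||d})+C_d\gamma^d_{b\nu}-\gamma^d_{be}\gamma^e_{d\nu}-\gamma^d_{b\epsilon}C^\epsilon_{\nu d}-\gamma^e_{bd}P^d_{\nu e}$, (k) $\mathring S_{bc}:=\mathring S^d_{bcd}=(\gamma^d_{bc||d}-C_{b||c})-C_d\gamma^d_{bc}+\gamma^d_{be}\gamma^e_{cd}$, (l) $\mathring{\mathcal S}:=g^{bc}\mathring S_{bc}=\frac12(\Omega^{ad}{}_{d||a}-C_a\Omega^{ad}{}_d)-C^d{}_{||d}+\gamma^{ad}{}_c\gamma^c_{da}$, where $\Omega^\alpha_{\beta\mu}:=\gamma^\alpha_{\beta\mu}+\gamma^\alpha_{\mu\beta}$ and $\Omega^a_{bc}:=\gamma^a_{bc}+\gamma^a_{cb}$.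
   Context: Let $M$ be a smooth paracompact $n$-manifold, $TM$ its tangent bundle with induced local coordinates $(x^\mu,y^a)$, and $N=(N^a_\mu(x,y))$ a given nonlinear connection on $TM$. Greek indices denote horizontal and Latin indices vertical components; both run over $1,\dots,n$; repeated indices (including the mesh index $i$) are summed. Put $\dot\partial_a=\partial/\partial y^a$, $\delta_\mu=\partial/\partial x^\mu-N^a_\mu\dot\partial_a$ (adapted frame $(\delta_\mu,\dot\partial_a)$) and $R^a_{\mu\nu}=\delta_\nu N^a_\mu-\delta_\mu N^a_\nu$. A $d$-connection is a linear connection $D$ on $TM$ preserving by parallelism the horizontal and the vertical distribution; its coefficients $(\Gamma^\alpha_{\mu\nu},\Gamma^a_{b\nu},C^\alpha_{\mu c},C^a_{bc})$ are defined by $D_{\delta_\nu}\delta_\mu=\Gamma^\alpha_{\mu\nu}\delta_\alpha$, $D_{\delta_\nu}\dot\partial_b=\Gamma^a_{b\nu}\dot\partial_a$, $D_{\dot\partial_c}\delta_\mu=C^\alpha_{\mu c}\delta_\alpha$, $D_{\dot\partial_c}\dot\partial_b=C^a_{bc}\dot\partial_a$. Its $h$- and $v$-covariant derivatives are $T^{\alpha a}{}_{\beta b|\mu}=\delta_\mu T^{\alpha a}_{\beta b}+T^{\epsilon a}_{\beta b}\Gamma^\alpha_{\epsilon\mu}+T^{\alpha d}_{\beta b}\Gamma^a_{d\mu}-T^{\alpha a}_{\epsilon b}\Gamma^\epsilon_{\beta\mu}-T^{\alpha a}_{\beta d}\Gamma^d_{b\mu}$, $T^{\alpha a}{}_{\beta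 b||c}=\dot\partial_cT^{\alpha a}_{\beta b}+T^{\epsilon a}_{\beta b}C^\alpha_{\epsilon c}+T^{\alpha d}_{\beta b}C^a_{dc}-T^{\alpha a}_{\epsilon b}C^\epsilon_{\beta c}-T^{\alpha a}_{\beta d}C^d_{bc}$, similarly for other types (each lower or upper index, Greek or Latin, contributes its term). Its curvature $\mathbf R(X,Y)Z=D_XD_YZ-D_YD_XZ-D_{[X,Y]}Z$ has components $\mathbf R(\delta_\mu,\delta_\nu)\delta_\beta=R^\alpha_{\beta\mu\nu}\delta_\alpha$, $\mathbf R(\delta_\mu,\delta_\nu)\dot\partial_b=R^a_{b\mu\nu}\dot\partial_a$, $\mathbf R(\dot\partial_c,\delta_\nu)\delta_\beta=P^\alpha_{\beta\nu c}\delta_\alpha$, $\mathbf R(\dot\partial_c,\delta_\nu)\dot\partial_b=P^a_{b\nu c}\dot\partial_a$, $\mathbf R(\dot\partial_b,\dot\partial_c)\delta_\beta=S^\alpha_{\beta bc}\delta_\alpha$, $\mathbf R(\dot\partial_c,\dot\partial_d)\dot\partial_b=S^a_{bcd}\dot\partial_a$. Those of $\mathring D$ carry a ring. EAP-space $(TM,\lambda)$: $TM$ with $N$ and $n$ vector fields $\lambda_i=\lambda_i^\alpha\delta_\alpha+\lambda_i^a\dot\partial_a$ ($i=1,\dots,n$) defined globally on $TM$ with linearly independent horizontal parts and linearly independent vertical parts. $(\lambda_{i\alpha})$, $(\lambda_{ia})$ are the inverse matrices of $(\lambda_i^\alpha)$, $(\lambda_i^a)$. Metric: $g_{\alpha\beta}=\lambda_{i\alpha}\lambda_{i\beta}$,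 $g_{ab}=\lambda_{ia}\lambda_{ib}$, with inverses $g^{\alpha\beta}$, $g^{ab}$. Natural metric $d$-connection $\mathring D$: $\mathring\Gamma^\alpha_{\mu\nu}=\frac12g^{\alpha\epsilon}(\delta_\mu g_{\epsilon\nu}+\delta_\nu g_{\epsilon\mu}-\delta_\epsilon g_{\mu\nu})$, $\mathring\Gamma^a_{b\nu}=\dot\partial_bN^a_\nu+\frac12g^{ac}(\delta_\nu g_{bc}-g_{dc}\dot\partial_bN^d_\nu-g_{bd}\dot\partial_cN^d_\nu)$, $\mathring C^\alpha_{\mu c}=\frac12g^{\alpha\epsilon}\dot\partial_cg_{\mu\epsilon}$, $\mathring C^a_{bc}=\frac12g^{ad}(\dot\partial_bg_{dc}+\dot\partial_cg_{db}-\dot\partial_dg_{bc})$. Canonical $d$-connection: $\Gamma^\alpha_{\mu\nu}=\lambda_i^\alpha\delta_\nu\lambda_{i\mu}$, $\Gamma^a_{b\nu}=\lambda_i^a\delta_\nu\lambda_{ib}$, $C^\alpha_{\mu c}=\lambda_i^\alpha\dot\partial_c\lambda_{i\mu}$, $C^a_{bc}=\lambda_i^a\dot\partial_c\lambda_{ib}$ (the unique $d$-connection making the horizontal and vertical parts of all $\lambda_i$ parallel). Its torsion components are $\Lambda^\alpha_{\mu\nu}=\Gamma^\alpha_{\mu\nu}-\Gamma^\alpha_{\nu\mu}$, $R^a_{\mu\nu}$, $C^\alpha_{\mu c}$, $P^a_{\mu c}=\dot\partial_cN^a_\mu-\Gamma^a_{c\mu}$, $T^a_{bc}=C^a_{bc}-C^a_{cb}$.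 Contortion: $\gamma^\alpha_{\mu\nu}=\Gamma^\alpha_{\mu\nu}-\mathring\Gamma^\alpha_{\mu\nu}$, $\gamma^a_{b\mu}=\Gamma^a_{b\mu}-\mathring\Gamma^a_{b\mu}$, $\gamma^\alpha_{\mu c}=C^\alpha_{\mu c}-\mathring C^\alpha_{\mu c}$, $\gamma^a_{bc}=C^a_{bc}-\mathring C^a_{bc}$. Also $C_\mu=\Lambda^\alpha_{\mu\alpha}=\gamma^\alpha_{\mu\alpha}$, $C_b=T^a_{ba}=\gamma^a_{ba}$. Indices are raised with the metric, the raised first lower index being placed second: $C^\mu=g^{\mu\beta}C_\beta$, $C^d=g^{db}C_b$, $\gamma^{\alpha\mu}{}_\epsilon=g^{\mu\beta}\gamma^\alpha_{\beta\epsilon}$, $\gamma^{\alpha\mu}{}_d=g^{\mu\beta}\gamma^\alpha_{\beta d}$, $\gamma^{ad}{}_c=g^{db}\gamma^a_{bc}$, $\Omega^{\alpha\mu}{}_\nu=g^{\mu\beta}\Omega^\alpha_{\beta\nu}$, $\Omega^{ad}{}_c=g^{db}\Omega^a_{bc}$. *)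

(* Defs.v *)
From HB Require Import structures.
From mathcomp Require Import all_boot all_order all_algebra.
From mathcomp Require Import all_classical all_reals all_analysis.

Set Implicit Arguments.
Unset Strict Implicit.
Unset Printing Implicit Defensive.

Import Order.TTheory GRing.Theory Num.Theory.
Import numFieldNormedType.Exports.

Local Open Scope classical_set_scope.
Local Open Scope ring_scope.

(* C^k and C^oo scalar functions on an open subset A of a normed space; in     *)
(* finite dimension, quantifying over all directions v is the same as         *)
(* quantifying over a basis.                                                  *)
Fixpoint Ck (R : realType) (V : normedModType R) (k : nat)
    (A : set V) (f : V -> R) : Prop :=
  (forall p, A p -> {for p, continuous f}) /\
  if k is k'.+1 then
    forall v : V, (forall p, A p -> derivable f p v) /\
                  Ck k' A (fun p => 'D_v f p)
  else True.

Definition smooth_on (R : realType) (V : normedModType R)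
    (A : set V) (f : V -> R) : Prop := forall k, Ck k A f.

Definition locally_finite (T : topologicalType) (W : set (set T)) : Prop :=
  forall x : T, exists O : set T,
    [/\ open O, O x & finite_set [set B | W B /\ B `&` O !=set0]].

Definition paracompact (T : topologicalType) : Prop :=
  forall (I : Type) (U : I -> set T),
    (forall i, open (U i)) -> \bigcup_i U i = setT ->
    exists W : set (set T),
      [/\ forall B, W B -> open B,
          \bigcup_(B in W) B = setT,
          forall B, W B -> exists i, B `<=` U i &
          locally_finite W].

(* The charts are those of an arbitrary smooth atlas; [param c] is the         *)
(* inverse of [coord c], meaningful on [coord c @` dom c] only.               *)
Record manifold (R : realType) (n : nat) := Manifold {
  carrier : topologicalType;
  mfd_hausdorff : hausdorff_space carrier;
  mfd_paracompact : paracompact carrier;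
  chart : Type;
  dom : chart -> set carrier;
  coord : chart -> carrier -> 'rV[R]_n;
  param : chart -> 'rV[R]_n -> carrier;
  dom_open : forall c, open (dom c);
  dom_cover : \bigcup_c dom c = setT;
  coordK : forall c m, dom c m -> param c (coord c m) = m;
  coord_open : forall c, open (coord c @` dom c);
  coord_cont : forall c m, dom c m -> {for m, continuous (coord c)};
  param_cont : forall c x, (coord c @` dom c) x -> {for x, continuous (param c)};
  transition_smooth : forall c c' mu,
    smooth_on (coord c @` (dom c `&` dom c'))
              (fun x => coord c' (param c x) 0 mu) }.

(* A point of a chart of TM: (x, y), with x^mu = p.1 0 mu, y^a = p.2 0 a.      *)
Notation tpoint R n := ('rV[R]_n * 'rV[R]_n)%type.

Section TangentBundle.
Variables (R : realType) (n : nat) (M : manifold R n).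
Implicit Types c : chart M.

Definition transition c c' (x : 'rV[R]_n) : 'rV[R]_n := coord c' (param c x).

(* Change of induced coordinates on TM:                                       *)
(* x'^mu = x'^mu(x), y'^a = (\partial x'^a / \partial x^b) y^b.               *)
Definition ttransition c c' (p : tpoint R n) : tpoint R n :=
  (transition c c' p.1, 'd (transition c c') (p.1) p.2).

Definition tdom c : set (tpoint R n) := [set p | (coord c @` dom c) p.1].

Definition tdom2 c c' : set (tpoint R n) :=
  [set p | (coord c @` (dom c `&` dom c')) p.1].

(* The horizontal tangent vector v^mu delta_mu in natural coordinates, where  *)
(* the entry (a, mu) of Np is N^a_mu.                                         *)
Definition hlift (Np : 'M[R]_n) (v : 'rV[R]_n) : tpoint R n :=
  (v, - (v *m Np^T)).

(* A nonlinear connection: local functions N^a_mu whose horizontal            *)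
(* subspaces are matched by the changes of induced coordinates, i.e.          *)
(* N'^a_mu \partial_nu x'^mu =                                                *)
(*   \partial_b x'^a N^b_nu - \partial_nu \partial_b x'^a y^b.                *)
Record nonlinear_connection := NonlinearConnection {
  Ncoef : chart M -> tpoint R n -> 'M[R]_n;
  Ncoef_smooth : forall c a mu,
    smooth_on (tdom c) (fun p => Ncoef c p a mu);
  Ncoef_compat : forall c c' p v, tdom2 c c' p ->
    'd (ttransition c c') p (hlift (Ncoef c p) v) =
    hlift (Ncoef c' (ttransition c c' p)) ('d (transition c c') (p.1) v) }.

(* A vector field on TM, by its components in the natural frames              *)
(* (\partial/\partial x^mu, \partial/\partial y^a) of the induced charts.     *)
Record tvector_field := TVectorField {
  vcoef : chart M -> tpoint R n -> tpoint R n;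
  vcoef_smooth1 : forall c mu,
    smooth_on (tdom c) (fun p => (vcoef c p).1 0 mu);
  vcoef_smooth2 : forall c a,
    smooth_on (tdom c) (fun p => (vcoef c p).2 0 a);
  vcoef_compat : forall c c' p, tdom2 c c' p ->
    'd (ttransition c c') p (vcoef c p) = vcoef c' (ttransition c c' p) }.

End TangentBundle.

(* The kind of an index or of a frame vector: horizontal (Greek) or vertical  *)
(* (Latin).                                                                   *)
Inductive part := Hor | Ver.

(* The data (N, lambda_1, ..., lambda_n) read in one induced chart;           *)
(* the lambda_i are given in the natural frame.                               *)
Record local_data (R : realType) (n : nat) := LocalData {
  Nloc : tpoint R n -> 'M[R]_n;
  floc : 'I_n -> tpoint R n -> tpoint R n }.

Section Local.
Variables (R : realType) (n : nat) (L : local_data R n).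
Notation pt := (tpoint R n).
Implicit Types (p q : pt) (f : pt -> R) (X Y Z : pt -> pt).
Implicit Types (k l : part).

Definition dx (mu : 'I_n) f p : R := 'D_((delta_mx 0 mu, 0) : pt) f p.
Definition dy (a : 'I_n) f p : R := 'D_((0, delta_mx 0 a) : pt) f p.

Definition delta (mu : 'I_n) f p : R :=
  dx mu f p - \sum_a Nloc L p a mu * dy a f p.

Definition frame_der k (j : 'I_n) : (pt -> R) -> pt -> R :=
  match k with Hor => delta j | Ver => dy j end.

(* The adapted frame as vector fields: delta_j for Hor, \dot\partial_j for    *)
(* Ver.                                                                       *)
Definition frame k (j : 'I_n) : pt -> pt :=
  match k with
  | Hor => fun p => (delta_mx 0 j, - \row_a Nloc L p a j)
  | Ver => fun=> (0, delta_mx 0 j)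
  end.

(* X = X^mu \partial_mu + X^a \dot\partial_a equals                             *)
(* X^mu delta_mu + (X^a + N^a_mu X^mu) \dot\partial_a.                         *)
Definition comp k X p (j : 'I_n) : R :=
  match k with
  | Hor => (X p).1 0 j
  | Ver => (X p).2 0 j + \sum_mu Nloc L p j mu * (X p).1 0 mu
  end.

Definition act X f p : R :=
  \sum_mu (X p).1 0 mu * dx mu f p + \sum_a (X p).2 0 a * dy a f p.

Definition bracket X Y p : pt :=
  (\row_mu (act X (fun q => (Y q).1 0 mu) p - act Y (fun q => (X q).1 0 mu) p),
   \row_a (act X (fun q => (Y q).2 0 a) p - act Y (fun q => (X q).2 0 a) p)).

Definition Rnl p (a mu nu : 'I_n) : R :=
  delta nu (fun q => Nloc L q a mu) p - delta mu (fun q => Nloc L q a nu) p.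

(* Arguments are in the order of the printed indices: upper, then lower.      *)
Record dconn := DConn {
  GammaH : pt -> 'I_n -> 'I_n -> 'I_n -> R;
  GammaV : pt -> 'I_n -> 'I_n -> 'I_n -> R;
  CH : pt -> 'I_n -> 'I_n -> 'I_n -> R;
  CV : pt -> 'I_n -> 'I_n -> 'I_n -> R }.

Implicit Types D : dconn.

(* D_{frame l c} (frame k b) = \sum_a coef D k l p a b c (frame k a). *)
Definition coef D k l : pt -> 'I_n -> 'I_n -> 'I_n -> R :=
  match k, l with
  | Hor, Hor => GammaH D | Ver, Hor => GammaV D
  | Hor, Ver => CH D     | Ver, Ver => CV D
  end.

(* D_X Z, by the Leibniz rule. *)
Definition nabla_comp D k X Z p (a : 'I_n) : R :=
  act X (fun q => comp k Z q a) p
  + \sum_b \sum_nu comp k Z p b * comp Hor X p nu * coef D k Hor p a b nu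
  + \sum_b \sum_c comp k Z p b * comp Ver X p c * coef D k Ver p a b c.

Definition nabla D X Z p : pt :=
  \sum_a nabla_comp D Hor X Z p a *: frame Hor a p
  + \sum_a nabla_comp D Ver X Z p a *: frame Ver a p.

Definition curv D X Y Z p : pt :=
  nabla D X (nabla D Y Z) p - nabla D Y (nabla D X Z) p
  - nabla D (bracket X Y) Z p.

(* Kind k is that of the first two indices. *)
Definition Rcurv D k p (a b mu nu : 'I_n) : R :=
  comp k (curv D (frame Hor mu) (frame Hor nu) (frame k b)) p a.
Definition Pcurv D k p (a b nu c : 'I_n) : R :=
  comp k (curv D (frame Ver c) (frame Hor nu) (frame k b)) p a.
Definition Scurv D k p (a b c d : 'I_n) : R :=
  comp k (curv D (frame Ver c) (frame Ver d) (frame k b)) p a.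

(* d-tensors, by the list of the positions and kinds of their indices. *)
Inductive slot := Up of part | Lo of part.

Fixpoint tensor (s : seq slot) : Type :=
  if s is _ :: s' then 'I_n -> tensor s' else R.

Fixpoint tadd (s : seq slot) : tensor s -> tensor s -> tensor s :=
  match s return tensor s -> tensor s -> tensor s with
  | [::] => fun t u => t + u
  | _ :: s' => fun t u i => @tadd s' (t i) (u i)
  end.

Fixpoint tsum (s : seq slot) : ('I_n -> R) -> ('I_n -> tensor s) -> tensor s :=
  match s return ('I_n -> R) -> ('I_n -> tensor s) -> tensor s with
  | [::] => fun w t => \sum_e t e * w e
  | _ :: s' => fun w t i => @tsum s' w (fun e => t e i)
  end.

Definition slot_coef D l (c : 'I_n) p (k : slot) (i e : 'I_n) : R :=
  match k with
  | Up k => coef D k l p i e c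
  | Lo k => - coef D k l p e i c
  end.

(* Components T_{|c} (l = Hor) and T_{||c} (l = Ver) of the covariant          *)
(* derivative; see covdE.                                                     *)
Fixpoint covd D (s : seq slot) l (c : 'I_n) :
    (pt -> tensor s) -> pt -> tensor s :=
  match s return (pt -> tensor s) -> pt -> tensor s with
  | [::] => fun T => frame_der l c T
  | k :: s' => fun T p i =>
      tadd (@covd D s' l c (fun q => T q i) p)
           (tsum (slot_coef D l c p k i) (T p))
  end.

Lemma covdE D l (c : 'I_n)
    (T : pt -> tensor [:: Up Hor; Up Ver; Lo Hor; Lo Ver]) p
    (alpha a beta b : 'I_n) :
  @covd D [:: Up Hor; Up Ver; Lo Hor; Lo Ver] l c T p alpha a beta b =
  frame_der l c (fun q => T q alpha a beta b) p
  + \sum_e T p e a beta b * coef D Hor l p alpha e c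
  + \sum_d T p alpha d beta b * coef D Ver l p a d c
  - \sum_e T p alpha a e b * coef D Hor l p e beta c
  - \sum_d T p alpha a beta d * coef D Ver l p d b c.
Proof.
rewrite /= -!sumrN.
under [X in _ + X + _ + _]eq_bigr do rewrite mulrN.
under [X in _ + X + _ + _ + _]eq_bigr do rewrite mulrN.
by rewrite [LHS](ACl (1*5*4*3*2)).
Qed.

(* lambda_i^alpha (k = Hor), lambda_i^a (k = Ver). *)
Definition lam k (i : 'I_n) p (a : 'I_n) : R := comp k (floc L i) p a.

Definition lam_mx k p : 'M[R]_n := \matrix_(i, a) lam k i p a.

(* lambda_{i alpha}, lambda_{i a}. *)
Definition colam k (i : 'I_n) p (a : 'I_n) : R := invmx (lam_mx k p) a i.

Definition met k p (a b : 'I_n) : R := \sum_i colam k i p a * colam k i p b.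

Definition imet k p (a b : 'I_n) : R := invmx (\matrix_(c, d) met k p c d) a b.

Definition canonical_dconn : dconn := {|
  GammaH := fun p alpha mu nu =>
    \sum_i lam Hor i p alpha * delta nu (fun q => colam Hor i q mu) p;
  GammaV := fun p a b nu =>
    \sum_i lam Ver i p a * delta nu (fun q => colam Ver i q b) p;
  CH := fun p alpha mu c =>
    \sum_i lam Hor i p alpha * dy c (fun q => colam Hor i q mu) p;
  CV := fun p a b c =>
    \sum_i lam Ver i p a * dy c (fun q => colam Ver i q b) p |}.

Definition natural_dconn : dconn := {|
  GammaH := fun p alpha mu nu =>
    2^-1 * \sum_e imet Hor p alpha e *
      (delta mu (fun q => met Hor q e nu) p
       + delta nu (fun q => met Hor q e mu) p
       - delta e (fun q => met Hor q mu nu) p);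
  GammaV := fun p a b nu =>
    dy b (fun q => Nloc L q a nu) p +
    2^-1 * \sum_c imet Ver p a c *
      (delta nu (fun q => met Ver q b c) p
       - \sum_d met Ver p d c * dy b (fun q => Nloc L q d nu) p
       - \sum_d met Ver p b d * dy c (fun q => Nloc L q d nu) p);
  CH := fun p alpha mu c =>
    2^-1 * \sum_e imet Hor p alpha e * dy c (fun q => met Hor q mu e) p;
  CV := fun p a b c =>
    2^-1 * \sum_d imet Ver p a d *
      (dy b (fun q => met Ver q d c) p
       + dy c (fun q => met Ver q d b) p
       - dy d (fun q => met Ver q b c) p) |}.

Definition LambdaT p (alpha mu nu : 'I_n) : R :=
  GammaH canonical_dconn p alpha mu nu - GammaH canonical_dconn p alpha nu mu.
Definition PT p (a mu c : 'I_n) : R :=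
  dy c (fun q => Nloc L q a mu) p - GammaV canonical_dconn p a c mu.
Definition TT p (a b c : 'I_n) : R :=
  CV canonical_dconn p a b c - CV canonical_dconn p a c b.

(* gam k l has kind k for its first two indices and l for the third:          *)
(* gamma^alpha_{mu nu}, gamma^a_{b mu}, gamma^alpha_{mu c}, gamma^a_{bc} are   *)
(* gam Hor Hor, gam Ver Hor, gam Hor Ver, gam Ver Ver.                        *)
Definition gam k l p (a b c : 'I_n) : R :=
  coef canonical_dconn k l p a b c - coef natural_dconn k l p a b c.

Definition Ctr k p (b : 'I_n) : R :=
  match k with
  | Hor => \sum_alpha LambdaT p alpha b alpha
  | Ver => \sum_a TT p a b a
  end.

Definition Omega k p (a b c : 'I_n) : R := gam k k p a b c + gam k k p a c b.

(* Raising: the raised first lower index is placed second. *)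
Definition Cup k p (d : 'I_n) : R := \sum_b imet k p d b * Ctr k p b.
Definition gamup k l p (a d c : 'I_n) : R :=
  \sum_b imet k p d b * gam k l p a b c.
Definition Omegaup k p (a d c : 'I_n) : R :=
  \sum_b imet k p d b * Omega k p a b c.

(* Covariant derivatives for the canonical d-connection, in the direction     *)
(* m = Hor for | and m = Ver for ||; the derivation index comes last.         *)
Definition gam_cov k l m p (a b c d : 'I_n) : R :=
  @covd canonical_dconn [:: Up k; Lo k; Lo l] m d (gam k l) p a b c.
Definition Ctr_cov k m p (b d : 'I_n) : R :=
  @covd canonical_dconn [:: Lo k] m d (Ctr k) p b.
Definition Cup_cov k m p (b d : 'I_n) : R :=
  @covd canonical_dconn [:: Up k] m d (Cup k) p b.
Definition Omegaup_cov k m p (a b c d : 'I_n) : R :=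
  @covd canonical_dconn [:: Up k; Up k; Lo k] m d (Omegaup k) p a b c.

Definition Rring := Rcurv natural_dconn.
Definition Pring := Pcurv natural_dconn.
Definition Sring := Scurv natural_dconn.

Definition RicR p (beta mu : 'I_n) : R :=
  \sum_alpha Rring Hor p alpha beta mu alpha.
Definition scalR p : R := \sum_beta \sum_mu imet Hor p beta mu * RicR p beta mu.
Definition RicPH p (beta c : 'I_n) : R :=
  - \sum_alpha Pring Hor p alpha beta alpha c.
Definition RicPV p (b nu : 'I_n) : R := \sum_d Pring Ver p d b nu d.
Definition RicS p (b c : 'I_n) : R := \sum_d Sring Ver p d b c d.
Definition scalS p : R := \sum_b \sum_c imet Ver p b c * RicS p b c.

End Local.

Definition local_rep (R : realType) (n : nat) (M : manifold R n)
    (N : nonlinear_connection M) (X : 'I_n -> tvector_field M) (c : chart M) :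
    local_data R n :=
  LocalData (Ncoef N c) (fun i => vcoef (X i) c).

Record EAP_space (R : realType) (n : nat) (M : manifold R n) := EAPSpace {
  EAP_N : nonlinear_connection M;
  EAP_lambda : 'I_n -> tvector_field M;
  EAP_free : forall k c p, tdom c p ->
    row_free (lam_mx (local_rep EAP_N EAP_lambda c) k p) }.

Definition EAP_local (R : realType) (n : nat) (M : manifold R n)
    (E : EAP_space M) (c : chart M) : local_data R n :=
  local_rep (EAP_N E) (EAP_lambda E) c.

(* Main.v *)
(* Write D for the canonical and D' for the natural d-connection, so that      *)
(* D' = D - gamma.  Then the curvature R' of D' satisfies                      *)
(*   R'(X, Y) = R(X, Y) - (D_X gamma)(Y) + (D_Y gamma)(X)                      *)
(*              + [gamma(X), gamma(Y)] - gamma(T(X, Y)),                       *)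
(* where T is the torsion of D, and R = 0 since D has a parallel frame; the    *)
(* latter rests on the symmetry of second derivatives.  Reading this in the    *)
(* adapted frame, for X and Y horizontal or vertical, gives (a)-(f).  For the  *)
(* traces, gamma^a_{ab} = 0 (both connections preserve the volume density of   *)
(* the metric), so gamma^a_{ba} = C_b, and contraction with the metric         *)
(* commutes with D because the metric is D-parallel.                           *)

Require Import Defs.
From mathcomp Require Import all_boot all_order all_algebra.
From mathcomp Require Import all_classical all_reals all_analysis.
From mathcomp Require Import ring.

Set Implicit Arguments.
Unset Strict Implicit.
Unset Printing Implicit Defensive.

Import Order.TTheory GRing.Theory Num.Theory.
Import numFieldNormedType.Exports.

Local Open Scope classical_set_scope.
Local Open Scope ring_scope.

(** * Smooth functions *)

(** Everything is computed in one chart, for local data smooth on an open set [A]. The kinds [k],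
    [l], [m] are kept as parameters, so that one identity yields several of the required formulas.

    The canonical connection is flat: its coefficients are $\lambda_i^a$ times frame derivatives of
    $\lambda_{ib}$, the $\lambda_i$ are parallel ([lam_parallel]), and so its curvature reduces to a
    commutator of frame derivatives of $\lambda_{ib}$ minus the bracket term, which cancel
    ([canonical_flat]). The commutator is computed in [frame_der_comm], where the second-order terms
    drop out by the symmetry of second derivatives ([derive_comm]). Substituting canonical minus
    contortion into the coordinate expression [curv_frame] gives [natural_curvature], which contains
    all six curvature formulas; the kinds of the two directions decide which torsion component
    appears.

    The traces use three more facts. Both connections have the same trace over the first two indices
    ([can_nat_trace]), whence $C_b=\gamma^a_{ba}$ ([Ctr_gam]). The purely horizontal and purely
    vertical natural coefficients are symmetric, so $\Lambda$ and $T$ are the skew parts of $\gamma$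
    ([gam_skew]), and the quadratic and torsion terms merge into one product ([natural_ricci]). The
    inverse metric is parallel ([imet_parallel]), so raising an index commutes with the covariant
    derivatives ([raise_parallel]), and its symmetry replaces $\gamma$ by $\frac12\Omega$ in the
    scalars ([natural_scalar]). *)

Section SmoothFunctions.
Variables (R : realType) (V : normedModType R) (A : set V).
Hypothesis oA : open A.
Implicit Types (f g : V -> R) (p v : V).

(** Since [A] is open, agreement on [A] is agreement near each of its points, which is all that
    limits and derivatives see. *)
Lemma open_near_eq f g p : (forall q, A q -> f q = g q) -> A p ->
  \near p, f p = g p.
Proof.
move=> fg Ap; have := open_nbhs_nbhs (conj oA Ap).
by apply: filterS => q; exact: fg.
Qed.

Lemma derive_ext_on f g v p : (forall q, A q -> f q = g q) -> A p ->
  'D_v f p = 'D_v g p.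
Proof. by move=> fg Ap; apply/near_eq_derive/open_near_eq. Qed.

Lemma Ck_continuous k f p : Ck k A f -> A p -> {for p, continuous f}.
Proof. by case: k => [|k] [+ _]; apply. Qed.

Lemma Ck_ext k f g : (forall q, A q -> f q = g q) -> Ck k A f -> Ck k A g.
Proof.
elim: k f g => [|k IH] f g fg [fc fd]; split.
- move=> p Ap; rewrite /prop_for /continuous_at -(fg _ Ap).
  by apply: cvg_trans (fc _ Ap); apply: near_eq_cvg; exact: open_near_eq.
- by [].
- move=> p Ap; rewrite /prop_for /continuous_at -(fg _ Ap).
  by apply: cvg_trans (fc _ Ap); apply: near_eq_cvg; exact: open_near_eq.
- move=> v; have [fdv fDv] := fd v; split.
    move=> p Ap; apply: near_eq_derivable (fdv _ Ap); exact: open_near_eq.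
  by apply: IH fDv => q Aq; exact: derive_ext_on.
Qed.

Lemma CkW k f : Ck k.+1 A f -> Ck k A f.
Proof.
elim: k f => [|k IH] f [fc fd]; split => // v.
by have [? ?] := fd v; split => //; apply: IH.
Qed.

Lemma Ck_cst k (a : R) : Ck k A (fun=> a).
Proof.
elim: k a => [|k IH] a; (split; first by move=> p _; exact: cvg_cst) => // v.
split; first by move=> p _; exact: derivable_cst.
by apply: Ck_ext (IH 0) => q _; rewrite derive_cst.
Qed.

Lemma Ck_add k f g : Ck k A f -> Ck k A g -> Ck k A (fun p => f p + g p).
Proof.
elim: k f g => [|k IH] f g [fc fd] [gc gd];
  (split; first by move=> p Ap; apply: cvgD; [exact: fc|exact: gc]) => // v.
have [fv fD] := fd v; have [gv gD] := gd v.
split; first by move=> p Ap; apply: derivableD; [exact: fv|exact: gv].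
apply: Ck_ext (IH _ _ fD gD) => q Aq.
by rewrite -deriveD//; [exact: fv|exact: gv].
Qed.

(** In the Leibniz rule one factor stays undifferentiated; [CkW] lowers its class so that the
    induction applies. *)
Lemma Ck_mul k f g : Ck k A f -> Ck k A g -> Ck k A (fun p => f p * g p).
Proof.
elim: k f g => [|k IH] f g fk gk; have [fc fd] := fk; have [gc gd] := gk;
  (split; first by move=> p Ap; apply: cvgM; [exact: fc|exact: gc]) => // v.
have [fv fD] := fd v; have [gv gD] := gd v.
split; first by move=> p Ap; apply: derivableM; [exact: fv|exact: gv].
apply: Ck_ext (Ck_add (IH _ _ (CkW fk) gD) (IH _ _ (CkW gk) fD)) => q Aq.
by rewrite (deriveM (fv _ Aq) (gv _ Aq)).
Qed.

Lemma Ck_inv k f : (forall p, A p -> f p != 0) ->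
  Ck k A f -> Ck k A (fun p => (f p)^-1).
Proof.
move=> f0; elim: k => [|k IH] fk; have [fc fd] := fk;
  (split; first by move=> p Ap; apply: cvgV; [exact: f0|exact: fc]) => // v.
have [fv fD] := fd v.
split; first by move=> p Ap; apply: derivableV; [exact: f0|exact: fv].
have ik := IH (CkW fk).
apply: Ck_ext (Ck_mul (Ck_mul (Ck_cst k (-1)) (Ck_mul ik ik)) fD) => q Aq.
rewrite deriveV//; [|exact: f0|exact: fv].
by rewrite /GRing.scale/= mulN1r expr2 invfM.
Qed.

Local Notation smooth := (smooth_on A).

Lemma smooth_ext f g : (forall q, A q -> f q = g q) -> smooth f -> smooth g.
Proof. by move=> fg fs k; apply: Ck_ext fg (fs k). Qed.

Lemma smooth_cst (a : R) : smooth (fun=> a).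
Proof. by move=> k; exact: Ck_cst. Qed.

Lemma smooth_add f g : smooth f -> smooth g -> smooth (fun p => f p + g p).
Proof. by move=> fs gs k; exact: Ck_add. Qed.

Lemma smooth_mul f g : smooth f -> smooth g -> smooth (fun p => f p * g p).
Proof. by move=> fs gs k; exact: Ck_mul. Qed.

Lemma smooth_opp f : smooth f -> smooth (fun p => - f p).
Proof.
move=> fs; apply: smooth_ext (smooth_mul (smooth_cst (-1)) fs) => q _.
by rewrite mulN1r.
Qed.

Lemma smooth_sub f g : smooth f -> smooth g -> smooth (fun p => f p - g p).
Proof. by move=> fs gs; apply: smooth_add => //; exact: smooth_opp. Qed.

Lemma smooth_inv f : (forall p, A p -> f p != 0) ->
  smooth f -> smooth (fun p => (f p)^-1).
Proof. by move=> f0 fs k; exact: Ck_inv. Qed.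

Lemma smooth_sum (I : Type) (r : seq I) (F : I -> V -> R) :
  (forall i, smooth (F i)) -> smooth (fun p => \sum_(i <- r) F i p).
Proof.
move=> Fs; elim: r => [|i r IH].
  by apply: smooth_ext (smooth_cst 0) => q _; rewrite big_nil.
by apply: smooth_ext (smooth_add (Fs i) IH) => q _; rewrite big_cons.
Qed.

Lemma smooth_prod (I : Type) (r : seq I) (F : I -> V -> R) :
  (forall i, smooth (F i)) -> smooth (fun p => \prod_(i <- r) F i p).
Proof.
move=> Fs; elim: r => [|i r IH].
  by apply: smooth_ext (smooth_cst 1) => q _; rewrite big_nil.
by apply: smooth_ext (smooth_mul (Fs i) IH) => q _; rewrite big_cons.
Qed.

Lemma smooth_derivable f v p : smooth f -> A p -> derivable f p v.
Proof. by move=> /(_ 1%N)[_ /(_ v)[+ _]] Ap; apply. Qed.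

Lemma smooth_derive f v : smooth f -> smooth (fun p => 'D_v f p).
Proof. by move=> fs k; have [_ /(_ v)[]] := fs k.+1. Qed.

Lemma smooth_continuous f p : smooth f -> A p -> {for p, continuous f}.
Proof. by move=> /(_ 0%N); exact: Ck_continuous. Qed.

Lemma smooth_det m (B : V -> 'M[R]_m) :
  (forall i j, smooth (fun p => B p i j)) ->
  smooth (fun p => \det (B p)).
Proof.
move=> Bs; apply: smooth_sum => s; apply: smooth_mul; first exact: smooth_cst.
exact: smooth_prod.
Qed.

(** By Cramer's rule the entries are cofactors divided by a determinant that does not vanish on [A].
    This makes the coframe $\lambda_{ia}$ smooth. *)
Lemma smooth_invmx m (B : V -> 'M[R]_m) :
  (forall p, A p -> B p \in unitmx) ->
  (forall i j, smooth (fun p => B p i j)) ->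
  forall i j, smooth (fun p => invmx (B p) i j).
Proof.
move=> Bu Bs i j.
apply: (@smooth_ext (fun p => (\det (B p))^-1 * cofactor (B p) j i)).
  by move=> q Aq; rewrite /invmx Bu// !mxE.
apply: smooth_mul.
  apply: smooth_inv; last exact: smooth_det.
  by move=> q /Bu; rewrite unitmxE unitfE.
apply: smooth_mul; first exact: smooth_cst.
by apply: smooth_det => k l; apply: smooth_ext (Bs (lift j k) (lift i l)) => q _;
  rewrite !mxE.
Qed.

End SmoothFunctions.

(** * Symmetry of second derivatives *)

Section Schwarz.
Variables (R : realType) (V : normedModType R).
Implicit Types (f g : V -> R) (p q u v : V).

(** The two difference quotients are the same function of the increment; this brings in the
    one-variable mean value theorem. *)
Lemma is_derive_line f v q (t : R) : derivable f (t *: v + q) v ->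
  is_derive t 1 (fun s : R => f (s *: v + q)) ('D_v f (t *: v + q)).
Proof.
have E : (fun h : R => h^-1 *: (((fun s : R => f (s *: v + q)) \o shift t) (h *: 1)
    - f (t *: v + q))) =
  (fun h : R => h^-1 *: ((f \o shift (t *: v + q)) (h *: v) - f (t *: v + q))).
  apply/funext => h /=; rewrite addrA -scalerDl.
  by congr (_ *: (f ((_ + _) *: _ + _) - _)); exact: mulr1.
by move=> df; split; rewrite /derivable /derive E.
Qed.

(** The mean value theorem is applied twice: along [v] to the difference [w] of [f] between two
    opposite sides of the parallelogram, then along [u] to the resulting difference of $D_vf$. *)
Lemma second_difference (A : set V) f p u v (h : R) : smooth_on A f -> 0 < h ->
  (forall s t, 0 <= s <= h -> 0 <= t <= h -> A (s *: u + (t *: v + p))) ->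
  exists s t, [/\ 0 <= s <= h, 0 <= t <= h &
    f (h *: u + (h *: v + p)) - f (h *: v + p) - (f (h *: u + p) - f p)
    = 'D_u (fun q => 'D_v f q) (s *: u + (t *: v + p)) * h * h].
Proof.
move=> fs h0 Asq.
have hh : 0 <= h <= h by rewrite ltW ?lexx.
have h00 : 0 <= (0 : R) <= h by rewrite lexx ltW.
pose w t := f (t *: v + (h *: u + p)) - f (t *: v + p).
have Av t : 0 <= t <= h -> A (t *: v + p).
  by move=> th; rewrite -[_ + p]add0r -(scale0r u); exact: Asq.
have Auv t : 0 <= t <= h -> A (t *: v + (h *: u + p)).
  by move=> th; rewrite addrCA; exact: Asq.
have dw t : 0 <= t <= h -> is_derive t 1 w
    ('D_v f (t *: v + (h *: u + p)) - 'D_v f (t *: v + p)).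
  by move=> th; apply: is_deriveB; apply: is_derive_line;
    apply: smooth_derivable fs _; [exact: Auv|exact: Av].
have sub t : t \in `]0, h[ -> 0 <= t <= h.
  by rewrite in_itv/= => /andP[/ltW -> /ltW ->].
have [t tin wE] : exists2 t, t \in `]0, h[ & w h - w 0 =
    ('D_v f (t *: v + (h *: u + p)) - 'D_v f (t *: v + p)) * (h - 0).
  apply: (@MVT R w (fun t =>
    'D_v f (t *: v + (h *: u + p)) - 'D_v f (t *: v + p)) 0 h h0).
    by move=> t /sub/dw.
  apply: derivable_within_continuous => t; rewrite in_itv/= => /dw.
  by case.
have th := sub _ tin.
pose z s := 'D_v f (s *: u + (t *: v + p)).
have dz s : 0 <= s <= h -> is_derive s 1 z
    ('D_u (fun q => 'D_v f q) (s *: u + (t *: v + p))).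
  move=> sh; apply: is_derive_line.
  by apply: smooth_derivable (Asq _ _ sh th); exact: smooth_derive.
have [s sin zE] : exists2 s, s \in `]0, h[ & z h - z 0 =
    'D_u (fun q => 'D_v f q) (s *: u + (t *: v + p)) * (h - 0).
  apply: (@MVT R z (fun s =>
    'D_u (fun q => 'D_v f q) (s *: u + (t *: v + p))) 0 h h0).
    by move=> s /sub/dz.
  apply: derivable_within_continuous => s; rewrite in_itv/= => /dz.
  by case.
exists s, t; split; [exact: sub|exact: th|].
move: wE zE; rewrite /w /z !subr0 !scale0r !add0r => wE zE.
by rewrite -zE [h *: u + (t *: v + p)]addrCA -wE [h *: v + (h *: u + p)]addrCA.
Qed.

(** The second difference is symmetric in [u] and [v], so the two mixed derivatives take a common
    value at two points of an arbitrarily small parallelogram at [p]; continuity at [p]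
    concludes. *)
Lemma derive_comm (A : set V) f p u v : open A -> smooth_on A f -> A p ->
  'D_u (fun q => 'D_v f q) p = 'D_v (fun q => 'D_u f q) p.
Proof.
move=> oA fs Ap; apply/eqP; rewrite -subr_eq0 -normr_le0.
apply/ler_addgt0Pr => e e0; rewrite add0r.
pose F q := 'D_u (fun q => 'D_v f q) q; pose G q := 'D_v (fun q => 'D_u f q) q.
rewrite -/(F p) -/(G p).
have Fc : {for p, continuous F}.
  by apply: smooth_continuous Ap; apply: smooth_derive; exact: smooth_derive.
have Gc : {for p, continuous G}.
  by apply: smooth_continuous Ap; apply: smooth_derive; exact: smooth_derive.
have e2 : 0 < e / 2 by rewrite divr_gt0.
have : \forall q \near p, [/\ A q, `|F p - F q| < e / 2 & `|G p - G q| < e / 2].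
  have nF : \forall q \near p, `|F p - F q| < e / 2.
    by apply/cvgr_dist_lt: e2; exact: Fc.
  have nG : \forall q \near p, `|G p - G q| < e / 2.
    by apply/cvgr_dist_lt: e2; exact: Gc.
  have nA := open_nbhs_nbhs (conj oA Ap).
  by apply: filterS3 nA nF nG => q.
move=> /nbhs_ballP[r /= r0 rP].
(* With this side length the parallelogram stays in the ball of radius [r]; the summand 1 keeps the
   denominator positive when [u] and [v] vanish. *)
pose h := r / (`|u| + `|v| + 1).
have d0 : 0 < `|u| + `|v| + 1 by rewrite ltr_wpDl// addr_ge0.
have h0 : 0 < h by rewrite divr_gt0.
have inr a b : 0 <= a <= h -> 0 <= b <= h -> ball p r (a *: u + (b *: v + p)).
  move=> /andP[a0 ah] /andP[b0 bh]; rewrite -ball_normE/= addrA opprD addrCA.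
  rewrite subrr addr0 normrN (le_lt_trans (ler_normD _ _))// !normrZ.
  rewrite !ger0_norm// (@le_lt_trans _ _ (h * (`|u| + `|v|)))//.
    by rewrite mulrDr lerD// ler_wpM2r.
  by rewrite /h mulrAC -mulrA gtr_pMr// ltr_pdivrMr// mul1r ltrDl.
have inr' a b : 0 <= a <= h -> 0 <= b <= h -> ball p r (a *: v + (b *: u + p)).
  by move=> ah bh; rewrite addrCA; exact: inr.
have [s [t [sh th E]]] := second_difference fs h0
  (fun a b ah bh => let: And3 Aq _ _ := rP _ (inr a b ah bh) in Aq).
have [s' [t' [sh' th' E']]] := second_difference fs h0
  (fun a b ah bh => let: And3 Aq _ _ := rP _ (inr' a b ah bh) in Aq).
have FG : F (s *: u + (t *: v + p)) = G (s' *: v + (t' *: u + p)).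
  have hn0 : h != 0 by rewrite gt_eqF.
  apply: (mulIf hn0); apply: (mulIf hn0).
  apply: (etrans (esym E)); apply: (etrans _ E').
  by rewrite [h *: u + (h *: v + p)]addrCA; ring.
have [_ + _] := rP _ (inr _ _ sh th); have [_ _] := rP _ (inr' _ _ sh' th').
rewrite FG => Gd Fd; clearbody F G.
rewrite -(subrKA (G (s' *: v + (t' *: u + p)))).
apply: le_trans (ler_normD _ _) _; rewrite [leRHS]splitr lerD// ltW//.
by rewrite distrC.
Qed.

End Schwarz.

(** * Curvature in the adapted frame *)

Local Arguments Defs.comp : simpl never.

Section Kronecker.
Variables (R : pzRingType) (n : nat).
Implicit Types (F : 'I_n -> R) (i j : 'I_n).

Lemma sum_kronl F j : \sum_i (i == j)%:R * F i = F j.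
Proof.
rewrite (bigD1 j)//= eqxx mul1r big1 ?addr0// => i /negPf ->.
by rewrite mul0r.
Qed.

Lemma sum_kronr F j : \sum_i F i * (i == j)%:R = F j.
Proof.
rewrite (bigD1 j)//= eqxx mulr1 big1 ?addr0// => i /negPf ->.
by rewrite mulr0.
Qed.

End Kronecker.

Section FrameCalculus.
Variables (R : realType) (n : nat) (L : local_data R n).
Local Notation pt := (tpoint R n).
Implicit Types (p q : pt) (f g : pt -> R) (X Y Z : pt -> pt) (k l m : part).
Implicit Types (D : dconn R n).

(** The vertical components of the Lie bracket of two adapted frame vectors, which determine it by
    [bracket_frame]. *)
Definition vbracket l (c : 'I_n) m (d : 'I_n) p (e : 'I_n) : R :=
  match l, m with
  | Hor, Hor => Rnl L p e c d
  | Ver, Hor => - dy c (fun q => Nloc L q e d) p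
  | Hor, Ver => dy d (fun q => Nloc L q e c) p
  | Ver, Ver => 0
  end.

Lemma act_frame l c f p : act (frame L l c) f p = frame_der L l c f p.
Proof.
rewrite /act; case: l => /=.
  rewrite /delta -sumrN; congr (_ + _).
    rewrite (eq_bigr (fun mu => (mu == c)%:R * dx mu f p)) ?sum_kronl//.
    by move=> mu _; rewrite mxE.
  by apply: eq_bigr => a _; rewrite !mxE mulNr.
rewrite [X in X + _]big1 ?add0r; last by move=> mu _; rewrite mxE mul0r.
rewrite (eq_bigr (fun mu => (mu == c)%:R * dy mu f p)) ?sum_kronl//.
by move=> mu _; rewrite mxE.
Qed.

Lemma comp_frame k b p a : Defs.comp L k (frame L k b) p a = (a == b)%:R.
Proof.
rewrite /Defs.comp; case: k => /=; first by rewrite mxE.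
by rewrite mxE/= big1 ?addr0// => mu _; rewrite mxE mulr0.
Qed.

Lemma comp_frame_hv b p a : Defs.comp L Hor (frame L Ver b) p a = 0.
Proof. by rewrite /Defs.comp/= mxE. Qed.

Lemma comp_frame_vh b p a : Defs.comp L Ver (frame L Hor b) p a = 0.
Proof.
rewrite /Defs.comp/= !mxE (eq_bigr (fun mu => Nloc L p a mu * (mu == b)%:R)).
  by rewrite sum_kronr addNr.
by move=> mu _; rewrite mxE.
Qed.

Lemma compD k X Y p a : Defs.comp L k (fun q => X q + Y q) p a =
  Defs.comp L k X p a + Defs.comp L k Y p a.
Proof.
rewrite /Defs.comp; case: k => /=; first by rewrite mxE.
rewrite mxE -!addrA; congr (_ + _); rewrite addrCA -big_split/=.
by congr (_ + _); apply: eq_bigr => mu _; rewrite mxE mulrDr.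
Qed.

Lemma compN k X p a : Defs.comp L k (fun q => - X q) p a =
  - Defs.comp L k X p a.
Proof.
rewrite /Defs.comp; case: k => /=; first by rewrite mxE.
rewrite mxE opprD -sumrN.
by congr (_ + _); apply: eq_bigr => mu _; rewrite mxE mulrN.
Qed.

Lemma compZ k (w : pt -> R) X p a :
  Defs.comp L k (fun q => w q *: X q) p a = w p * Defs.comp L k X p a.
Proof.
rewrite /Defs.comp; case: k => /=; first by rewrite mxE.
rewrite mxE mulrDr mulr_sumr.
by congr (_ + _); apply: eq_bigr => mu _; rewrite mxE mulrCA.
Qed.

Lemma comp0 k p a : Defs.comp L k (fun=> 0) p a = 0.
Proof.
rewrite /Defs.comp; case: k => /=; first by rewrite mxE.
by rewrite mxE big1 ?addr0// => mu _; rewrite mxE mulr0.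
Qed.

Lemma comp_sum (I : Type) (r : seq I) k (F : I -> pt -> pt) p a :
  Defs.comp L k (fun q => \sum_(i <- r) F i q) p a =
  \sum_(i <- r) Defs.comp L k (F i) p a.
Proof.
elim: r => [|i r IH]; rewrite ?(big_nil, big_cons).
  rewrite -[RHS](comp0 k p a); congr (Defs.comp L k _ p a).
  by apply/funext => q; rewrite big_nil.
rewrite -IH -compD; congr (Defs.comp L k _ p a).
by apply/funext => q; rewrite big_cons.
Qed.

Lemma comp_nabla D k X Z p a :
  Defs.comp L k (nabla L D X Z) p a = nabla_comp L D k X Z p a.
Proof.
rewrite /nabla compD !comp_sum.
under eq_bigr do rewrite compZ.
under [X in _ + X]eq_bigr do rewrite compZ.
have S (w : 'I_n -> R) : \sum_e w e * (a == e)%:R = w a.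
  by rewrite -(sum_kronr w a); apply: eq_bigr => e _; rewrite eq_sym.
case: k.
  under eq_bigr do rewrite comp_frame.
  under [X in _ + X]eq_bigr do rewrite comp_frame_hv mulr0.
  by rewrite S big1 ?addr0.
under eq_bigr do rewrite comp_frame_vh mulr0.
under [X in _ + X]eq_bigr do rewrite comp_frame.
by rewrite S big1 ?add0r.
Qed.

Lemma nabla_comp_framel D k l c Z p a :
  nabla_comp L D k (frame L l c) Z p a =
  frame_der L l c (fun q => Defs.comp L k Z q a) p
  + \sum_b Defs.comp L k Z p b * coef D k l p a b c.
Proof.
rewrite /nabla_comp act_frame -addrA; congr (_ + _).
rewrite -big_split/=; apply: eq_bigr => b _.
case: l.
  rewrite [X in _ + X]big1 ?addr0; last first.
    by move=> e _; rewrite comp_frame_vh mulr0 mul0r.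
  rewrite -[RHS](sum_kronr (fun nu => Defs.comp L k Z p b * coef D k Hor p a b nu)).
  by apply: eq_bigr => nu _; rewrite comp_frame mulrAC.
rewrite big1 ?add0r; last first.
  by move=> e _; rewrite comp_frame_hv mulr0 mul0r.
rewrite -[RHS](sum_kronr (fun nu => Defs.comp L k Z p b * coef D k Ver p a b nu)).
by apply: eq_bigr => nu _; rewrite comp_frame mulrAC.
Qed.

Lemma act_cst X (r : R) p : act X (fun=> r) p = 0.
Proof.
rewrite /act !big1 ?addr0// => j _; first by rewrite /dy derive_cst mulr0.
by rewrite /dx derive_cst mulr0.
Qed.

Lemma frame_der_cst l c (r : R) p : frame_der L l c (fun=> r) p = 0.
Proof. by rewrite -act_frame act_cst. Qed.

Lemma nabla_comp_framer D k X b p a :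
  nabla_comp L D k X (frame L k b) p a =
  \sum_nu Defs.comp L Hor X p nu * coef D k Hor p a b nu
  + \sum_c Defs.comp L Ver X p c * coef D k Ver p a b c.
Proof.
rewrite /nabla_comp.
under eq_fun do rewrite comp_frame.
rewrite act_cst add0r; congr (_ + _).
  rewrite -[RHS](sum_kronl
    (fun b => \sum_nu Defs.comp L Hor X p nu * coef D k Hor p a b nu) b).
  apply: eq_bigr => e _; rewrite mulr_sumr; apply: eq_bigr => nu _.
  by rewrite comp_frame mulrA.
rewrite -[RHS](sum_kronl
  (fun b => \sum_c Defs.comp L Ver X p c * coef D k Ver p a b c) b).
apply: eq_bigr => e _; rewrite mulr_sumr; apply: eq_bigr => nu _.
by rewrite comp_frame mulrA.
Qed.

Lemma nabla_frame D k l b c p a :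
  Defs.comp L k (nabla L D (frame L l c) (frame L k b)) p a = coef D k l p a b c.
Proof.
rewrite comp_nabla nabla_comp_framel.
under eq_fun do rewrite comp_frame.
rewrite frame_der_cst add0r.
under eq_bigr do rewrite comp_frame.
by rewrite (sum_kronl (fun e => coef D k l p a e c)).
Qed.

Lemma nabla2_frame D k l m a b c d p :
  Defs.comp L k (nabla L D (frame L l c) (nabla L D (frame L m d) (frame L k b))) p a
  = frame_der L l c (fun q => coef D k m q a b d) p
    + \sum_e coef D k m p e b d * coef D k l p a e c.
Proof.
rewrite comp_nabla nabla_comp_framel.
under eq_fun do rewrite nabla_frame.
by under eq_bigr do rewrite nabla_frame.
Qed.

(** * Derivatives along the adapted frame, brackets and curvature coefficients *)

Section OnOpen.
Variable A : set pt.
Hypotheses (oA : open A)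
  (Nsm : forall a mu, smooth_on A (fun p => Nloc L p a mu)).

Lemma frame_der_ext l c f g p : (forall q, A q -> f q = g q) -> A p ->
  frame_der L l c f p = frame_der L l c g p.
Proof.
move=> fg Ap; have E v := derive_ext_on oA v fg Ap.
case: l => /=; last exact: E.
by rewrite /delta /dx /dy E; under eq_bigr do rewrite E.
Qed.

Lemma frame_derD l c f g p : smooth_on A f -> smooth_on A g -> A p ->
  frame_der L l c (fun q => f q + g q) p =
  frame_der L l c f p + frame_der L l c g p.
Proof.
move=> fs gs Ap; have E v : 'D_v (fun q => f q + g q) p = 'D_v f p + 'D_v g p.
  by rewrite -deriveD//; apply: smooth_derivable Ap.
case: l => /=; last exact: E.
rewrite /delta /dx /dy E; under eq_bigr do rewrite E mulrDr.
by rewrite big_split/= opprD addrACA.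
Qed.

Lemma frame_derM l c f g p : smooth_on A f -> smooth_on A g -> A p ->
  frame_der L l c (fun q => f q * g q) p =
  frame_der L l c f p * g p + f p * frame_der L l c g p.
Proof.
move=> fs gs Ap.
have E v : 'D_v (fun q => f q * g q) p = 'D_v f p * g p + f p * 'D_v g p.
  rewrite (deriveM (smooth_derivable fs Ap) (smooth_derivable gs Ap)).
  by rewrite addrC mulrC.
case: l => /=; last exact: E.
rewrite /delta /dx /dy E; under eq_bigr do rewrite E mulrDr.
rewrite big_split/= opprD mulrBl mulrBr addrACA mulr_suml mulr_sumr.
by congr (_ - _ + (_ - _)); apply: eq_bigr => a _; ring.
Qed.

Lemma frame_derN l c f p : smooth_on A f -> A p ->
  frame_der L l c (fun q => - f q) p = - frame_der L l c f p.
Proof.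
move=> fs Ap; have E v : 'D_v (fun q => - f q) p = - 'D_v f p.
  by rewrite -deriveN//; apply: smooth_derivable Ap.
case: l => /=; last exact: E.
rewrite /delta /dx /dy E opprB -sumrN addrC.
under eq_bigr do rewrite E mulrN.
by rewrite !sumrN opprK addrC.
Qed.

Lemma frame_derB l c f g p : smooth_on A f -> smooth_on A g -> A p ->
  frame_der L l c (fun q => f q - g q) p =
  frame_der L l c f p - frame_der L l c g p.
Proof.
move=> fs gs Ap; rewrite frame_derD//; last exact: smooth_opp.
by rewrite frame_derN.
Qed.

Lemma frame_der_sum (I : Type) (r : seq I) l c (F : I -> pt -> R) p :
  (forall i, smooth_on A (F i)) -> A p ->
  frame_der L l c (fun q => \sum_(i <- r) F i q) p =
  \sum_(i <- r) frame_der L l c (F i) p.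
Proof.
move=> Fs Ap; elim: r => [|i r IH].
  rewrite big_nil -[RHS](frame_der_cst l c 0 p).
  by congr (frame_der _ _ _ _ _); apply/funext => q; rewrite big_nil.
rewrite big_cons -IH -frame_derD//; last exact: smooth_sum.
by congr (frame_der _ _ _ _ _); apply/funext => q; rewrite big_cons.
Qed.

Lemma smooth_frame_der l c f : smooth_on A f -> smooth_on A (frame_der L l c f).
Proof.
move=> fs; case: l => /=; last exact: smooth_derive.
apply: smooth_sub => //; first exact: smooth_derive.
apply: smooth_sum => // a; apply: smooth_mul => //.
exact: smooth_derive.
Qed.

(** The natural horizontal components of the frame vectors are constant, so the bracket is vertical
    and only derivatives of $N$ survive. *)
Lemma bracket_frame l c m d p : A p ->
  bracket (frame L l c) (frame L m d) p = (0, \row_e vbracket l c m d p e).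
Proof.
move=> Ap; rewrite /bracket.
have H1 l' c' j : (fun q => (frame L l' c' q).1 0 j) =
    (fun=> if l' is Hor then (j == c')%:R else 0).
  by apply/funext => q; case: l' => /=; rewrite mxE.
have V1 l' c' X e : A p -> act X (fun q => (frame L l' c' q).2 0 e) p =
    if l' is Hor then - act X (fun q => Nloc L q e c') p else 0.
  move=> _; case: l' => /=; last first.
    rewrite (_ : (fun q => _) = fun=> (e == c')%:R) ?act_cst//.
    by apply/funext => q; rewrite mxE.
  rewrite (_ : (fun q => _) = fun q => - Nloc L q e c'); last first.
    by apply/funext => q; rewrite !mxE.
  have E v : 'D_v (fun q => - Nloc L q e c') p = - 'D_v (fun q => Nloc L q e c') p.
    by rewrite -deriveN//; apply: smooth_derivable (Nsm _ _) Ap.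
  rewrite /act opprD; congr (_ + _); rewrite -sumrN; apply: eq_bigr => j _;
    by rewrite /dx /dy E mulrN.
congr pair; apply/rowP => e; rewrite !mxE.
  by rewrite !H1 !act_cst subrr.
rewrite !V1//; case: l m => [] []; rewrite ?act_frame/= /Rnl.
- by rewrite opprK addrC.
- by rewrite sub0r opprK.
- by rewrite subr0.
- by rewrite subrr.
Qed.

Lemma comp_bracketH l c m d p e : A p ->
  Defs.comp L Hor (bracket (frame L l c) (frame L m d)) p e = 0.
Proof. by move=> Ap; rewrite /Defs.comp bracket_frame//= mxE. Qed.

Lemma comp_bracketV l c m d p e : A p ->
  Defs.comp L Ver (bracket (frame L l c) (frame L m d)) p e = vbracket l c m d p e.
Proof.
move=> Ap; rewrite /Defs.comp bracket_frame//= mxE big1 ?addr0// => mu _.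
by rewrite mxE mulr0.
Qed.

(** The usual coordinate expression of curvature in a non-holonomic frame; as the bracket is
    vertical, the last sum involves only vertical directions. *)
Lemma curv_frame D k l m a b c d p : A p ->
  Defs.comp L k (curv L D (frame L l c) (frame L m d) (frame L k b)) p a =
  frame_der L l c (fun q => coef D k m q a b d) p
  - frame_der L m d (fun q => coef D k l q a b c) p
  + (\sum_e coef D k m p e b d * coef D k l p a e c
     - \sum_e coef D k l p e b c * coef D k m p a e d)
  - \sum_e vbracket l c m d p e * coef D k Ver p a b e.
Proof.
move=> Ap.
have compB2 X Y Z :
    Defs.comp L k (fun q => X q - Y q - Z q) p a =
    Defs.comp L k X p a - Defs.comp L k Y p a - Defs.comp L k Z p a.
  by rewrite (compD k (fun q => X q - Y q) (fun q => - Z q)) compD !compN.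
apply: etrans (compB2 _ _ _) _; rewrite !nabla2_frame.
rewrite comp_nabla nabla_comp_framer [X in _ - (X + _)]big1 ?add0r; last first.
  by move=> nu _; rewrite comp_bracketH// mul0r.
under [X in _ - X]eq_bigr do rewrite comp_bracketV//.
by rewrite opprD addrACA.
Qed.

Lemma frame_der_comm l c m d f p : smooth_on A f -> A p ->
  frame_der L l c (frame_der L m d f) p - frame_der L m d (frame_der L l c f) p
  = \sum_e vbracket l c m d p e * dy e f p.
Proof.
move=> fs Ap.
have E u v := derive_comm u v oA fs Ap.
have dys e : smooth_on A (dy e f) by exact: smooth_derive.
have dxs e : smooth_on A (dx e f) by exact: smooth_derive.
have Ns a mu e : smooth_on A (fun q => Nloc L q a mu * dy e f q) by exact: smooth_mul.
(* By symmetry of second derivatives, moving a constant-direction derivative past $\delta_\mu$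
   leaves only the terms where it hits the coefficients $N$. *)
have Dd v mu : 'D_v (delta L mu f) p = delta L mu (fun q => 'D_v f q) p
    - \sum_a 'D_v (fun q => Nloc L q a mu) p * dy a f p.
  have Dsum : 'D_v (fun q => \sum_a Nloc L q a mu * dy a f q) p =
      \sum_a 'D_v (fun q => Nloc L q a mu * dy a f q) p.
    rewrite -derive_sum; last by move=> a; apply: smooth_derivable Ap.
    by congr ('D_v _ p); apply/funext => q; rewrite fct_sumE.
  rewrite /delta (deriveB (smooth_derivable (dxs mu) Ap)); last first.
    by apply: smooth_derivable Ap; exact: smooth_sum.
  rewrite Dsum E -addrA -opprD -big_split/=; congr (_ - _).
  apply: eq_bigr => a _.
  rewrite (deriveM (smooth_derivable (Nsm _ _) Ap) (smooth_derivable (dys _) Ap)).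
  have -> : 'D_v (dy a f) p = dy a (fun q => 'D_v f q) p by exact: E.
  by rewrite /GRing.scale/= [X in _ + X]mulrC.
case: l m => [] [] /=.
- have -> : delta L d (delta L c f) p = delta L d (dx c f) p
      - \sum_a (delta L d (fun q => Nloc L q a c) p * dy a f p
               + Nloc L p a c * delta L d (dy a f) p).
    rewrite -[LHS]/(frame_der L Hor d (fun q => _ - _) p).
    rewrite frame_derB//; last exact: smooth_sum.
    rewrite frame_der_sum//; congr (_ - _).
    by apply: eq_bigr => a _; rewrite frame_derM.
  have Ddx : dx c (delta L d f) p = delta L d (dx c f) p
      - \sum_a dx c (fun q => Nloc L q a d) p * dy a f p by exact: Dd.
  have Ddy b : dy b (delta L d f) p = delta L d (dy b f) p
      - \sum_a dy b (fun q => Nloc L q a d) p * dy a f p by exact: Dd.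
  rewrite [delta L c (delta L d f) p]/delta Ddx.
  under [X in _ - _ - X - _]eq_bigr do rewrite Ddy mulrBr mulr_sumr.
  under [RHS]eq_bigr do
    rewrite /Rnl [delta L c _ _]/delta opprB addrCA 2!mulrDl mulNr mulr_suml.
  rewrite sumrB exchange_big/= !big_split/= sumrN.
  under [X in _ = X + _]eq_bigr do under eq_bigr do rewrite -mulrA.
  ring.
- by rewrite /dy Dd opprB addrC subrK.
- by rewrite /dy Dd addrAC subrr sub0r -sumrN; apply: eq_bigr => e _; rewrite mulNr.
- by rewrite /dy E subrr big1// => e _; rewrite mul0r.
Qed.

End OnOpen.
End FrameCalculus.

(** * The contortion *)

Section Contortion.
Variables (R : realType) (n : nat) (L : local_data R n) (A : set (tpoint R n)).
Local Notation pt := (tpoint R n).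
Implicit Types (p q : pt) (k l m : part) (a b c d e i j : 'I_n).
Local Notation can := (coef (canonical_dconn L)).
Local Notation nat_ := (coef (natural_dconn L)).
Local Notation F := (frame_der L).
Hypotheses (oA : open A)
  (Nsm : forall a mu, smooth_on A (fun p => Nloc L p a mu))
  (Lsm : forall k i a, smooth_on A (fun p => lam L k i p a))
  (Lfree : forall k p, A p -> row_free (lam_mx L k p)).

(** * The frame, its coframe and the metric *)

Lemma lam_mx_unit k p : A p -> lam_mx L k p \in unitmx.
Proof. by move=> Ap; rewrite -row_free_unit; exact: Lfree. Qed.

Lemma lam_colam k i j p : A p ->
  \sum_a lam L k i p a * colam L k j p a = (i == j)%:R.
Proof.
move=> Ap; have := mulmxV (lam_mx_unit k Ap) => /matrixP/(_ i j).
by rewrite !mxE => <-; apply: eq_bigr => a _; rewrite mxE.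
Qed.

Lemma colam_lam k a b p : A p ->
  \sum_i colam L k i p a * lam L k i p b = (a == b)%:R.
Proof.
move=> Ap; have := mulVmx (lam_mx_unit k Ap) => /matrixP/(_ a b).
by rewrite !mxE => <-; apply: eq_bigr => i _; rewrite [in RHS]mxE.
Qed.

Lemma smooth_colam k i a : smooth_on A (fun p => colam L k i p a).
Proof.
apply: (smooth_invmx oA (B := lam_mx L k)) => [p|b c]; first exact: lam_mx_unit.
by apply: (smooth_ext oA) (Lsm k b c) => p _; rewrite mxE.
Qed.

Lemma smooth_met k a b : smooth_on A (fun p => met L k p a b).
Proof.
by apply: (smooth_sum oA) => i; apply: (smooth_mul oA); exact: smooth_colam.
Qed.

Lemma metC k p a b : met L k p a b = met L k p b a.
Proof. by apply: eq_bigr => i _; rewrite mulrC. Qed.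

(** If $B$ is the matrix of the $\lambda_i$, the metric is $B^{-1}B^{-T}$, whose inverse is $B^TB$.
    Smoothness and parallelism of the inverse metric are read off from this form. *)
Lemma imetE k p a b : A p ->
  imet L k p a b = \sum_i lam L k i p a * lam L k i p b.
Proof.
move=> Ap; have lU := lam_mx_unit k Ap; rewrite /imet.
have -> : \matrix_(c, d) met L k p c d =
    invmx (lam_mx L k p) *m (invmx (lam_mx L k p))^T.
  by apply/matrixP => c d; rewrite !mxE; apply: eq_bigr => i _; rewrite mxE.
have -> : invmx (invmx (lam_mx L k p) *m (invmx (lam_mx L k p))^T)
    = (lam_mx L k p)^T *m lam_mx L k p.
  set B := lam_mx L k p in lU *.
  have E : (B^T *m B) *m (invmx B *m (invmx B)^T) = 1%:M.
    by rewrite mulmxA mulmxK// -trmx_mul mulVmx// trmx1.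
  have CU := mulmx1_unit E.
  by rewrite -[LHS]mul1mx -E mulmxK//; case: CU.
by rewrite mxE; apply: eq_bigr => i _; rewrite !mxE.
Qed.

Lemma imetC k p a b : A p -> imet L k p a b = imet L k p b a.
Proof. by move=> Ap; rewrite !imetE//; apply: eq_bigr => i _; rewrite mulrC. Qed.

Lemma smooth_imet k a b : smooth_on A (fun p => imet L k p a b).
Proof.
apply: (@smooth_ext _ _ _ oA (fun p => \sum_i lam L k i p a * lam L k i p b)).
  by move=> p Ap; rewrite imetE.
by apply: (smooth_sum oA) => i; apply: (smooth_mul oA).
Qed.

Lemma imet_colam k i e p : A p ->
  \sum_a imet L k p a e * colam L k i p a = lam L k i p e.
Proof.
move=> Ap; under eq_bigr do rewrite imetE// mulr_suml.
rewrite exchange_big -[RHS](sum_kronl (fun j => lam L k j p e)).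
apply: eq_bigr => j _; rewrite -(lam_colam k j i Ap) mulr_suml.
by apply: eq_bigr => a _; rewrite mulrAC.
Qed.

(** * The connection coefficients; parallelism and flatness for the canonical connection *)

Lemma canE k l p a b c :
  can k l p a b c = \sum_i lam L k i p a * F l c (fun q => colam L k i q b) p.
Proof. by case: k; case: l. Qed.

Lemma smooth_can k l a b c : smooth_on A (fun p => can k l p a b c).
Proof.
apply: (@smooth_ext _ _ _ oA
  (fun p => \sum_i lam L k i p a * F l c (fun q => colam L k i q b) p)).
  by move=> p _; rewrite canE.
apply: (smooth_sum oA) => i; apply: (smooth_mul oA) => //.
by apply: (smooth_frame_der oA) => //; exact: smooth_colam.
Qed.

Lemma nat_diagE k p a b c : nat_ k k p a b c =
  2^-1 * \sum_e imet L k p a e *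
    (F k b (fun q => met L k q e c) p + F k c (fun q => met L k q e b) p
     - F k e (fun q => met L k q b c) p).
Proof. by case: k. Qed.

Lemma smooth_nat k l a b c : smooth_on A (fun p => nat_ k l p a b c).
Proof.
have Fm k' l' c' a' b' : smooth_on A (F l' c' (fun q => met L k' q a' b')).
  by apply: (smooth_frame_der oA) => //; exact: smooth_met.
have FN b' a' nu : smooth_on A (dy b' (fun q => Nloc L q a' nu)).
  exact: smooth_derive.
have halfS g : smooth_on A g -> smooth_on A (fun p => 2^-1 * g p).
  by apply: (smooth_mul oA); exact: (smooth_cst oA).
have imS k' a' (g : 'I_n -> pt -> R) : (forall e, smooth_on A (g e)) ->
    smooth_on A (fun p => \sum_e imet L k' p a' e * g e p).
  move=> gs; apply: (smooth_sum oA) => e.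
  by apply: (smooth_mul oA) => //; exact: smooth_imet.
have diagS k' : smooth_on A (fun p => nat_ k' k' p a b c).
  under eq_fun do rewrite nat_diagE.
  apply/halfS/imS => e; apply: (smooth_sub oA) => //.
  exact: (smooth_add oA).
case: k l => [] []; [exact: (diagS Hor)| | |exact: (diagS Ver)].
  by apply/halfS/imS => e; exact: (Fm Hor Ver c b e).
apply: (smooth_add oA); first exact: FN.
have mN (x y z t : 'I_n -> 'I_n) u : smooth_on A (fun p =>
    \sum_d met L Ver p (x d) (y d) * dy (z d) (fun q => Nloc L q (t d) u) p).
  apply: (smooth_sum oA) => d.
  by apply: (smooth_mul oA); [exact: smooth_met|exact: FN].
apply/halfS/imS => e; apply: (smooth_sub oA); last first.
  exact: (mN (fun=> b) id (fun=> e) id c).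
apply: (smooth_sub oA); last exact: (mN id (fun=> e) (fun=> b) id c).
exact: (Fm Ver Hor c b e).
Qed.

Lemma smooth_gam k l a b c : smooth_on A (fun p => gam L k l p a b c).
Proof. by apply: (smooth_sub oA); [exact: smooth_can|exact: smooth_nat]. Qed.

(** The canonical coefficients are defined through derivatives of the coframe; differentiating
    $\lambda_i^e\lambda_{je}=\delta_{ij}$ transfers parallelism to the frame. *)
Lemma lam_parallel k l i a c p : A p ->
  F l c (fun q => lam L k i q a) p = - \sum_e lam L k i p e * can k l p a e c.
Proof.
move=> Ap; under eq_bigr do rewrite canE mulr_sumr.
have E j : \sum_e lam L k i p e * F l c (fun q => colam L k j q e) p =
    - \sum_e F l c (fun q => lam L k i q e) p * colam L k j p e.
  apply/eqP; rewrite -addr_eq0 addrC -big_split/=.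
  have FM e := frame_derM L l c (Lsm k i e) (smooth_colam k j e) Ap.
  under eq_bigr do rewrite -FM.
  rewrite -(frame_der_sum L oA)//; last first.
    by move=> e; apply: (smooth_mul oA) => //; exact: smooth_colam.
  rewrite (@frame_der_ext _ _ _ _ oA _ _ _ (fun=> (i == j)%:R))// ?frame_der_cst//.
  by move=> q Aq; rewrite lam_colam.
rewrite exchange_big/=.
under eq_bigr do (under eq_bigr do rewrite mulrCA; rewrite -mulr_sumr E mulrN mulr_sumr).
rewrite sumrN opprK exchange_big/=.
rewrite -[LHS](sum_kronr (fun e => F l c (fun q => lam L k i q e) p)).
apply: eq_bigr => e _; rewrite -(colam_lam k e a Ap) mulr_sumr.
by apply: eq_bigr => j _; ring.
Qed.

(** The inverse metric is a sum of products of parallel fields. *)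
Lemma imet_parallel k l a b c p : A p ->
  F l c (fun q => imet L k q a b) p =
  - \sum_e imet L k p e b * can k l p a e c
  - \sum_e imet L k p a e * can k l p b e c.
Proof.
move=> Ap.
rewrite (@frame_der_ext _ _ _ _ oA _ _ _
  (fun q => \sum_i lam L k i q a * lam L k i q b)) //; last first.
  by move=> q Aq; rewrite imetE.
rewrite (frame_der_sum L oA)//; last by move=> i; exact: (smooth_mul oA).
under eq_bigr do
  rewrite (@frame_derM _ _ L A)// !lam_parallel// mulNr mulrN mulr_suml mulr_sumr.
rewrite big_split/= !sumrN; congr (- _ - _).
  rewrite exchange_big/=; apply: eq_bigr => e _.
  by rewrite imetE// mulr_suml; apply: eq_bigr => i _; ring.
rewrite exchange_big/=; apply: eq_bigr => e _.
by rewrite imetE// mulr_suml; apply: eq_bigr => i _; ring.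
Qed.

Lemma canonical_flat k l m a b c d p : A p ->
  F l c (fun q => can k m q a b d) p - F m d (fun q => can k l q a b c) p
  + (\sum_e can k m p e b d * can k l p a e c
     - \sum_e can k l p e b c * can k m p a e d)
  = \sum_e vbracket L l c m d p e * can k Ver p a b e.
Proof.
move=> Ap.
(* By [lam_parallel], the derivative falling on $\lambda_i^a$ cancels the quadratic term, leaving
   second derivatives of the coframe, whose skew part is given by [frame_der_comm]. *)
have E l' c' m' d' : F l' c' (fun q => can k m' q a b d') p
    + \sum_e can k m' p e b d' * can k l' p a e c' =
    \sum_i lam L k i p a * F l' c' (F m' d' (fun q => colam L k i q b)) p.
  have Fs i : smooth_on A (F m' d' (fun q => colam L k i q b)).
    by apply: (smooth_frame_der oA) => //; exact: smooth_colam.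
  under eq_fun do rewrite canE.
  rewrite (frame_der_sum L oA)//; last by move=> i; exact: (smooth_mul oA).
  under eq_bigr do rewrite (@frame_derM _ _ L A)// lam_parallel// mulNr mulr_suml.
  rewrite big_split/= sumrN addrAC -[RHS]add0r; congr (_ + _).
  rewrite addrC exchange_big/= -sumrB big1// => e _; apply/eqP.
  rewrite subr_eq0 canE mulr_suml; apply/eqP.
  by apply: eq_bigr => i _; ring.
rewrite addrACA -opprD E.
rewrite [X in _ - X]E -sumrB.
have Fcomm i := frame_der_comm oA Nsm l c m d (smooth_colam k i b) Ap.
under eq_bigr do rewrite -mulrBr Fcomm.
under eq_bigr do rewrite mulr_sumr.
rewrite exchange_big/=; apply: eq_bigr => e _; rewrite canE mulr_sumr.
by apply: eq_bigr => i _; rewrite mulrCA.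
Qed.

Lemma gam_covE k l m p a b c d : gam_cov L k l m p a b c d =
  F m d (fun q => gam L k l q a b c) p
  + \sum_e gam L k l p e b c * can k m p a e d
  - \sum_e can k m p e b d * gam L k l p a e c
  - \sum_e gam L k l p a b e * can l m p e c d.
Proof.
rewrite /gam_cov /=.
under [X in _ + X + _ + _]eq_bigr do rewrite mulrN.
under [X in _ + _ + X + _]eq_bigr do rewrite mulrN mulrC.
by rewrite !sumrN [LHS](ACl (1*4*3*2)).
Qed.

(* With nat = can - gam, flatness of the canonical connection removes every    *)
(* term without gam.                                                           *)
Lemma natural_curvature k l m a b c d p : A p ->
  Defs.comp L k (curv L (natural_dconn L)
    (frame L l c) (frame L m d) (frame L k b)) p a =
  (gam_cov L k l m p a b c d - gam_cov L k m l p a b d c)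
  + (\sum_e gam L k m p e b d * gam L k l p a e c
     - \sum_e gam L k l p e b c * gam L k m p a e d)
  - \sum_e gam L k m p a b e * can m l p e d c
  + \sum_e gam L k l p a b e * can l m p e c d
  + \sum_e gam L k Ver p a b e * vbracket L l c m d p e.
Proof.
move=> Ap; rewrite (curv_frame Nsm)//.
have natE k' l' q a' b' c' :
    nat_ k' l' q a' b' c' = can k' l' q a' b' c' - gam L k' l' q a' b' c'.
  by rewrite /gam subKr.
under eq_fun do rewrite natE.
under [X in _ - F _ _ X _]eq_fun do rewrite natE.
have FB l' c' m' d' := frame_derB L oA l' c'
  (smooth_can k m' a b d') (smooth_gam k m' a b d') Ap.
rewrite !FB.
have prodE (x y z w : 'I_n -> R) : \sum_e (x e - y e) * (z e - w e) =
    \sum_e x e * z e - \sum_e x e * w e - \sum_e y e * z e + \sum_e y e * w e.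
  by rewrite -!sumrB -big_split/=; apply: eq_bigr => e _; ring.
have quad l' c' m' d' : \sum_e nat_ k l' p e b c' * nat_ k m' p a e d' =
    \sum_e can k l' p e b c' * can k m' p a e d'
    - \sum_e can k l' p e b c' * gam L k m' p a e d'
    - \sum_e gam L k l' p e b c' * can k m' p a e d'
    + \sum_e gam L k l' p e b c' * gam L k m' p a e d'.
  by rewrite -prodE; apply: eq_bigr => e _; rewrite !natE.
have lin : \sum_e vbracket L l c m d p e * nat_ k Ver p a b e =
    \sum_e vbracket L l c m d p e * can k Ver p a b e
    - \sum_e gam L k Ver p a b e * vbracket L l c m d p e.
  by rewrite -sumrB; apply: eq_bigr => e _; rewrite natE; ring.
rewrite !quad lin -(canonical_flat k l m a b c d Ap) !gam_covE.
ring.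
Qed.

(** * Symmetry, traces and raising of indices *)

Lemma nat_diagC k p a b c : nat_ k k p a b c = nat_ k k p a c b.
Proof.
rewrite !nat_diagE; congr (_ * _); apply: eq_bigr => e _; congr (_ * (_ - _)).
  exact: addrC.
by congr (F _ _ _ _); apply/funext => q; exact: metC.
Qed.

(* Both traces are the logarithmic derivative of the volume density. *)
Lemma can_nat_trace k p c : A p ->
  \sum_a can k k p a a c = \sum_a nat_ k k p a a c.
Proof.
move=> Ap; under [RHS]eq_bigr do rewrite nat_diagE.
have Fmet e a : F k c (fun q => met L k q e a) p =
    \sum_i (F k c (fun q => colam L k i q e) p * colam L k i p a
            + colam L k i p e * F k c (fun q => colam L k i q a) p).
  have cS := smooth_colam.
  rewrite /met (frame_der_sum L oA)//; last by move=> i; exact: (smooth_mul oA).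
  by apply: eq_bigr => i _; rewrite (@frame_derM _ _ L A).
(* In the trace of the Christoffel formula [u] cancels against its transpose. What is left is half
   of [v], and [v] sums to twice [f], whose sum is the canonical trace. *)
pose u a e := imet L k p a e * F k a (fun q => met L k q e c) p.
pose v a e := imet L k p a e * F k c (fun q => met L k q e a) p.
pose f a e := imet L k p a e *
  \sum_i colam L k i p e * F k c (fun q => colam L k i q a) p.
have fE : \sum_a \sum_e f a e =
    \sum_a \sum_i lam L k i p a * F k c (fun q => colam L k i q a) p.
  apply: eq_bigr => a _; rewrite /f.
  under eq_bigr do rewrite mulr_sumr.
  rewrite exchange_big/=; apply: eq_bigr => i _.
  rewrite -(imet_colam k i a Ap) mulr_suml.
  by apply: eq_bigr => e _; rewrite (imetC k a e Ap) mulrA.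
have vE : \sum_a \sum_e v a e = 2 * \sum_a \sum_e f a e.
  rewrite mulr_natl mulr2n [X in _ + X]exchange_big/= -big_split/=.
  apply: eq_bigr => a _; rewrite -big_split/=; apply: eq_bigr => e _.
  rewrite /f (imetC k e a Ap) -mulrDr -big_split/= /v Fmet.
  by congr (_ * _); apply: eq_bigr => i _; ring.
have -> : \sum_a 2^-1 * \sum_e imet L k p a e *
      (F k a (fun q => met L k q e c) p + F k c (fun q => met L k q e a) p
       - F k e (fun q => met L k q a c) p) =
    2^-1 * (\sum_a \sum_e u a e + \sum_a \sum_e v a e - \sum_a \sum_e u e a).
  rewrite -mulr_sumr -big_split/= -sumrB; congr (_ * _).
  apply: eq_bigr => a _; rewrite -big_split/= -sumrB; apply: eq_bigr => e _.
  by rewrite /u (imetC k e a Ap) /v; ring.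
rewrite [X in _ - X]exchange_big/= addrAC subrr add0r vE mulKf ?pnatr_eq0// fE.
by apply: eq_bigr => a _; rewrite canE.
Qed.

(** In the trace of the torsion, the term $\Gamma^a_{ab}$ may be replaced by its natural
    counterpart, which by symmetry equals the natural trace over the outer indices. *)
Lemma Ctr_gam k p b : A p -> Ctr L k p b = \sum_a gam L k k p a b a.
Proof.
move=> Ap.
have -> : Ctr L k p b = \sum_a (can k k p a b a - can k k p a a b) by case: k.
rewrite /gam !sumrB (can_nat_trace k b Ap); congr (_ - _).
by apply: eq_bigr => a _; rewrite nat_diagC.
Qed.

Lemma gam_skew k p e a c :
  can k k p e a c - can k k p e c a = gam L k k p e a c - gam L k k p e c a.
Proof. by rewrite /gam (nat_diagC k p e a c); ring. Qed.

Lemma Ctr_covE k m p b d : Ctr_cov L k m p b d =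
  F m d (fun q => Ctr L k q b) p - \sum_e can k m p e b d * Ctr L k p e.
Proof.
rewrite /Ctr_cov/=; congr (_ + _); rewrite -sumrN.
by apply: eq_bigr => e _; rewrite mulrN mulrC.
Qed.

(** Covariant differentiation commutes with contraction: the corrections for the upper and the lower
    contracted index cancel. *)
Lemma gam_cov_trace k m p b d : A p ->
  \sum_a gam_cov L k k m p a b a d = Ctr_cov L k m p b d.
Proof.
move=> Ap; rewrite Ctr_covE.
rewrite (@frame_der_ext _ _ L _ oA _ _ _ 
  (fun q => \sum_a gam L k k q a b a))//; last first.
  by move=> q Aq; rewrite Ctr_gam.
rewrite (frame_der_sum L oA)//; last by move=> a; exact: smooth_gam.
under eq_bigr do rewrite gam_covE.
rewrite !sumrB big_split/= [X in _ + X - _ - _]exchange_big/=.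
rewrite addrAC addrK; congr (_ - _); rewrite exchange_big/=.
by apply: eq_bigr => e _; rewrite Ctr_gam// mulr_sumr.
Qed.

(** Raising commutes with covariant differentiation, by [imet_parallel]. Only the correction for the
    raised index is displayed; further indices of a tensor are treated as fixed labels of [T]. *)
Lemma raise_parallel k m (T : 'I_n -> pt -> R) a d p :
  (forall b, smooth_on A (T b)) -> A p ->
  F m d (fun q => \sum_b imet L k q a b * T b q) p
  + \sum_e can k m p a e d * (\sum_b imet L k p e b * T b p) =
  \sum_b imet L k p a b * (F m d (T b) p - \sum_e can k m p e b d * T e p).
Proof.
move=> Ts Ap.
have iS b : smooth_on A (fun q => imet L k q a b) by exact: smooth_imet.
have FM b := frame_derM L m d (iS b) (Ts b) Ap.
have iP b := imet_parallel k m a b d Ap.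
rewrite (frame_der_sum L oA)//; last by move=> b; exact: (smooth_mul oA).
under eq_bigr do rewrite FM iP mulrDl mulNr mulNr.
under [RHS]eq_bigr do rewrite mulrBr.
rewrite big_split/= sumrB !big_split/= !sumrN.
have -> : \sum_b (\sum_e imet L k p e b * can k m p a e d) * T b p =
    \sum_e can k m p a e d * \sum_b imet L k p e b * T b p.
  under eq_bigr do rewrite mulr_suml.
  rewrite exchange_big/=; apply: eq_bigr => e _.
  by rewrite mulr_sumr; apply: eq_bigr => b _; ring.
have -> : \sum_b (\sum_e imet L k p a e * can k m p b e d) * T b p =
    \sum_b imet L k p a b * \sum_e can k m p e b d * T e p.
  under eq_bigr do rewrite mulr_suml.
  rewrite exchange_big/=; apply: eq_bigr => e _.
  by rewrite mulr_sumr; apply: eq_bigr => b _; rewrite mulrA.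
by rewrite addrAC [X in X + _]addrAC addNr add0r addrC.
Qed.

Lemma smooth_Ctr k b : smooth_on A (fun q => Ctr L k q b).
Proof.
apply: (@smooth_ext _ _ _ oA (fun q => \sum_a gam L k k q a b a)).
  by move=> q Aq; rewrite Ctr_gam.
by apply: (smooth_sum oA) => e; exact: smooth_gam.
Qed.

Lemma smooth_Omega k a b c : smooth_on A (fun q => Omega L k q a b c).
Proof. by apply: (smooth_add oA); exact: smooth_gam. Qed.

Lemma Cup_cov_raise k m p a d : A p ->
  Cup_cov L k m p a d = \sum_b imet L k p a b * Ctr_cov L k m p b d.
Proof.
move=> Ap; under eq_bigr do rewrite Ctr_covE.
rewrite -(raise_parallel k m a d (smooth_Ctr k) Ap).
rewrite /Cup_cov/=; congr (_ + _).
by apply: eq_bigr => e _; rewrite mulrC.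
Qed.

Lemma Omegaup_cov_raise k m p a b c d : A p -> Omegaup_cov L k m p a b c d =
  \sum_x imet L k p b x * (gam_cov L k k m p a x c d + gam_cov L k k m p a c x d).
Proof.
move=> Ap.
(* The right-hand side is the covariant derivative of $\Omega$ written out, with the correction for
   the index [x] to be raised placed next to the frame derivative, as [raise_parallel] requires. *)
have step x : gam_cov L k k m p a x c d + gam_cov L k k m p a c x d =
   F m d (fun q => Omega L k q a x c) p - \sum_e can k m p e x d * Omega L k p a e c
   - \sum_e can k m p e c d * Omega L k p a x e
   + \sum_e can k m p a e d * Omega L k p e x c.
  have FD := frame_derD L m d (smooth_gam k k a x c)
    (smooth_gam k k a c x) Ap.
  rewrite !gam_covE FD.
  have OD (a' b' c' : 'I_n -> 'I_n) (w' : 'I_n -> R) :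
      \sum_e w' e * Omega L k p (a' e) (b' e) (c' e) =
      \sum_e w' e * gam L k k p (a' e) (b' e) (c' e)
      + \sum_e w' e * gam L k k p (a' e) (c' e) (b' e).
    by rewrite -big_split/=; apply: eq_bigr => e _; rewrite -mulrDr.
  rewrite (OD (fun=> a) id (fun=> c)) (OD (fun=> a) (fun=> x) id).
  rewrite (OD id (fun=> x) (fun=> c)).
  have C (u v : 'I_n -> R) : \sum_e u e * v e = \sum_e v e * u e.
    by apply: eq_bigr => e _; rewrite mulrC.
  rewrite [\sum_e gam _ _ _ _ e x c * _]C [\sum_e gam _ _ _ _ e c x * _]C.
  rewrite [\sum_e gam _ _ _ _ a x e * _]C [\sum_e gam _ _ _ _ a c e * _]C.
  ring.
under eq_bigr do rewrite step mulrDr mulrBr.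
rewrite big_split/= sumrB -(raise_parallel k m b d (fun x => smooth_Omega k a x c) Ap).
rewrite /Omegaup_cov/= [LHS](ACl (1*3*2*4)); congr (_ + _ + _ + _).
- by apply: eq_bigr => e _; rewrite mulrC.
- rewrite -sumrN; under [RHS]eq_bigr do rewrite mulr_sumr -sumrN.
  rewrite exchange_big/=; apply: eq_bigr => e _.
  by rewrite mulrN mulr_suml -sumrN; apply: eq_bigr => x _; ring.
- under [RHS]eq_bigr do rewrite mulr_sumr.
  rewrite exchange_big/=; apply: eq_bigr => e _.
  by rewrite mulr_suml; apply: eq_bigr => x _; ring.
Qed.

(** * Ricci and scalar contractions *)

(** One contraction for both kinds: [k = Hor] gives the horizontal Ricci tensor, [k = Ver] the
    vertical one, where the bracket term vanishes. *)
Lemma natural_ricci k b c p : A p ->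
  \sum_a Defs.comp L k (curv L (natural_dconn L)
    (frame L k c) (frame L k a) (frame L k b)) p a =
  (\sum_a gam_cov L k k k p a b c a - Ctr_cov L k k p b c)
  - \sum_e Ctr L k p e * gam L k k p e b c
  + \sum_a \sum_e gam L k k p a b e * gam L k k p e c a
  + \sum_a \sum_d gam L k Ver p a b d * vbracket L k c k a p d.
Proof.
move=> Ap.
under eq_bigr do rewrite natural_curvature//.
have split7 (f1 f2 f3 f4 f5 f6 f7 : 'I_n -> R) :
    \sum_a (f1 a - f2 a + (f3 a - f4 a) - f5 a + f6 a + f7 a) =
    \sum_a f1 a - \sum_a f2 a + (\sum_a f3 a - \sum_a f4 a) - \sum_a f5 a
    + \sum_a f6 a + \sum_a f7 a.
  by rewrite !big_split/= !sumrN.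
rewrite split7 gam_cov_trace//.
have -> : \sum_e Ctr L k p e * gam L k k p e b c =
    \sum_a \sum_e gam L k k p e b c * gam L k k p a e a.
  rewrite exchange_big/=; apply: eq_bigr => e _.
  by rewrite Ctr_gam// mulr_suml; apply: eq_bigr => a _; rewrite mulrC.
(* By [gam_skew], $\gamma^e_{ca}$ is $\gamma^e_{ac}$ minus torsion, so the single product in the
   conclusion accounts for the quadratic and the torsion terms of the curvature. *)
have -> : \sum_a \sum_e gam L k k p a b e * gam L k k p e c a =
   \sum_a \sum_e gam L k k p a b e * gam L k k p e a c
   - (\sum_a \sum_e gam L k k p a b e * can k k p e a c
   - \sum_a \sum_e gam L k k p a b e * can k k p e c a).
  rewrite -!sumrB; apply: eq_bigr => a _; rewrite -!sumrB; apply: eq_bigr => e _.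
  by rewrite -mulrBr gam_skew; ring.
rewrite [X in _ + (X - _) - _ + _ + _ = _]exchange_big/=.
ring.
Qed.

Lemma natural_scalar k p : A p ->
  \sum_b \sum_c imet L k p b c * (\sum_a Defs.comp L k (curv L (natural_dconn L)
    (frame L k c) (frame L k a) (frame L k b)) p a) =
  2^-1 * (\sum_a \sum_d Omegaup_cov L k k p a d d a
          - \sum_a \sum_d Ctr L k p a * Omegaup L k p a d d)
  - \sum_d Cup_cov L k k p d d
  + \sum_a \sum_d \sum_c gamup L k k p a d c * gam L k k p c d a
  + \sum_a \sum_c \sum_d gamup L k Ver p a c d * vbracket L k c k a p d.
Proof.
move=> Ap; under eq_bigr do under eq_bigr do rewrite natural_ricci//.
have split5 (w f1 f2 f3 f4 f5 : 'I_n -> 'I_n -> R) :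
    \sum_b \sum_c w b c * (f1 b c - f2 b c - f3 b c + f4 b c + f5 b c) =
    \sum_b \sum_c w b c * f1 b c - \sum_b \sum_c w b c * f3 b c
    - \sum_b \sum_c w b c * f2 b c + \sum_b \sum_c w b c * f4 b c
    + \sum_b \sum_c w b c * f5 b c.
  rewrite -!sumrB -!big_split/=; apply: eq_bigr => b _.
  by rewrite -!sumrB -!big_split/=; apply: eq_bigr => c _; ring.
rewrite (split5 (imet L k p)).
(* The source of the factor $\frac12$: contracted with the symmetric metric, $\Omega$ counts
   $\gamma$ twice. *)
have symm (g : 'I_n -> 'I_n -> R) :
    \sum_d \sum_x imet L k p d x * (g x d + g d x) =
    2 * \sum_b \sum_c imet L k p b c * g b c.
  rewrite mulr_natl mulr2n [X in X + _]exchange_big/= -big_split/=.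
  apply: eq_bigr => d _; rewrite -big_split/=; apply: eq_bigr => x _.
  by rewrite (imetC k d x Ap) mulrDr.
have gather (t : 'I_n -> 'I_n -> 'I_n -> R) :
    \sum_b \sum_c imet L k p b c * \sum_a t a b c =
    \sum_a \sum_b \sum_c imet L k p b c * t a b c.
  rewrite [RHS]exchange_big/=; apply: eq_bigr => b _.
  rewrite [RHS]exchange_big/=; apply: eq_bigr => c _.
  by rewrite mulr_sumr.
have lower k' (t : 'I_n -> 'I_n -> 'I_n -> R) :
    \sum_b \sum_c imet L k p b c * (\sum_a \sum_e gam L k k' p a b e * t a c e) =
    \sum_a \sum_d \sum_e gamup L k k' p a d e * t a d e.
  rewrite gather; apply: eq_bigr => a _; rewrite exchange_big/=.
  apply: eq_bigr => d _; under eq_bigr do rewrite mulr_sumr.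
  rewrite exchange_big/=; apply: eq_bigr => e _.
  rewrite /gamup mulr_suml; apply: eq_bigr => b _.
  by rewrite (imetC k b d Ap) mulrA.
rewrite (lower k (fun a c e => gam L k k p e c a)).
rewrite (lower Ver (fun a c e => vbracket L k c k a p e)).
congr (_ - _ + _ + _).
  rewrite 2!gather mulrBr; congr (_ - _).
    rewrite mulr_sumr; apply: eq_bigr => a _.
    under [X in _ * X]eq_bigr do rewrite Omegaup_cov_raise//.
    by rewrite (symm (fun b c => gam_cov L k k k p a b c a)) mulKf// pnatr_eq0.
  rewrite mulr_sumr; apply: eq_bigr => e _.
  rewrite -mulr_sumr /Omegaup mulrCA.
  rewrite (symm (fun b c => gam L k k p e b c)) mulKf ?pnatr_eq0//.
  rewrite mulr_sumr; apply: eq_bigr => b _; rewrite mulr_sumr.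
  by apply: eq_bigr => c _; rewrite mulrCA.
rewrite exchange_big/=; apply: eq_bigr => d _; rewrite Cup_cov_raise//.
by apply: eq_bigr => b _; rewrite (imetC k b d Ap).
Qed.

(** * The individual formulas, with the torsion components identified *)

Lemma sum_mulB (g u v : 'I_n -> R) :
  \sum_e g e * (u e - v e) = \sum_e g e * u e - \sum_e g e * v e.
Proof. by rewrite -sumrB; apply: eq_bigr => e _; rewrite mulrBr. Qed.

Lemma natural_Rcurv k a b mu nu p : A p -> Rring L k p a b mu nu =
  (gam_cov L k Hor Hor p a b mu nu - gam_cov L k Hor Hor p a b nu mu)
  + (\sum_e gam L k Hor p e b nu * gam L k Hor p a e mu
     - \sum_e gam L k Hor p e b mu * gam L k Hor p a e nu)
  - \sum_e gam L k Hor p a b e * LambdaT L p e nu mu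
  - \sum_d gam L k Ver p a b d * Rnl L p d nu mu.
Proof.
move=> Ap; rewrite [LHS]natural_curvature//.
have -> : \sum_e gam L k Ver p a b e * vbracket L Hor mu Hor nu p e =
    - \sum_d gam L k Ver p a b d * Rnl L p d nu mu.
  by rewrite -sumrN; apply: eq_bigr => e _; rewrite -mulrN;
    congr (_ * _); rewrite [RHS]opprB.
have -> : \sum_e gam L k Hor p a b e * LambdaT L p e nu mu =
    \sum_e gam L k Hor p a b e * can Hor Hor p e nu mu
    - \sum_e gam L k Hor p a b e * can Hor Hor p e mu nu by exact: sum_mulB.
ring.
Qed.

(** The bracket of a vertical and a horizontal frame vector contributes $-\dot\partial_cN^e_\nu$,
    which joins the coefficient $\Gamma^e_{c\nu}$ to form $-P^e_{\nu c}$. *)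
Lemma natural_Pcurv k a b nu c p : A p -> Pring L k p a b nu c =
  (gam_cov L k Ver Hor p a b c nu - gam_cov L k Hor Ver p a b nu c)
  + (\sum_e gam L k Hor p e b nu * gam L k Ver p a e c
     - \sum_e gam L k Ver p e b c * gam L k Hor p a e nu)
  - \sum_e gam L k Hor p a b e * can Hor Ver p e nu c
  - \sum_d gam L k Ver p a b d * PT L p d nu c.
Proof.
move=> Ap; rewrite [LHS]natural_curvature//.
have -> : \sum_e gam L k Ver p a b e * vbracket L Ver c Hor nu p e =
    - \sum_e gam L k Ver p a b e * dy c (fun q => Nloc L q e nu) p.
  by rewrite -sumrN; apply: eq_bigr => e _; rewrite mulrN.
have -> : \sum_d gam L k Ver p a b d * PT L p d nu c =
    \sum_e gam L k Ver p a b e * dy c (fun q => Nloc L q e nu) p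
    - \sum_e gam L k Ver p a b e * can Ver Hor p e c nu by exact: sum_mulB.
ring.
Qed.

Lemma natural_Scurv k a b c d p : A p -> Sring L k p a b c d =
  (gam_cov L k Ver Ver p a b c d - gam_cov L k Ver Ver p a b d c)
  + (\sum_e gam L k Ver p e b d * gam L k Ver p a e c
     - \sum_e gam L k Ver p e b c * gam L k Ver p a e d)
  - \sum_e gam L k Ver p a b e * TT L p e d c.
Proof.
move=> Ap; rewrite [LHS]natural_curvature//.
rewrite [X in _ + X = _]big1 ?addr0; last by move=> e _; rewrite mulr0.
have -> : \sum_e gam L k Ver p a b e * TT L p e d c =
    \sum_e gam L k Ver p a b e * can Ver Ver p e d c
    - \sum_e gam L k Ver p a b e * can Ver Ver p e c d by exact: sum_mulB.
ring.
Qed.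

Lemma sum_split6 (f1 f2 f3 f4 f5 f6 : 'I_n -> R) :
  \sum_a (f1 a - f2 a + (f3 a - f4 a) - f5 a - f6 a) =
  \sum_a f1 a - \sum_a f2 a + (\sum_a f3 a - \sum_a f4 a) - \sum_a f5 a
  - \sum_a f6 a.
Proof. by rewrite !big_split/= !sumrN. Qed.

(** The contracted direction is the horizontal one, so it is $\gamma^\alpha_{\beta\nu||c}$ that
    contracts to a derivative of $C_\beta$; in [natural_RicPV] the vertical direction is contracted
    and the two derivative terms exchange roles. *)
Lemma natural_RicPH beta c p : A p -> RicPH L p beta c =
  (Ctr_cov L Hor Ver p beta c
   - \sum_a gam_cov L Hor Ver Hor p a beta c a)
  + \sum_e Ctr L Hor p e * gam L Hor Ver p e beta c
  + \sum_a \sum_e gam L Hor Hor p a beta e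
      * (can Hor Ver p e a c - gam L Hor Ver p e a c)
  + \sum_a \sum_d gam L Hor Ver p a beta d * PT L p d a c.
Proof.
move=> Ap; rewrite /RicPH.
under eq_bigr do rewrite natural_Pcurv//.
rewrite sum_split6 gam_cov_trace//.
have -> : \sum_e Ctr L Hor p e * gam L Hor Ver p e beta c =
    \sum_a \sum_e gam L Hor Ver p e beta c * gam L Hor Hor p a e a.
  rewrite [RHS]exchange_big; apply: eq_bigr => e _.
  by rewrite Ctr_gam// mulr_suml; apply: eq_bigr => a _; rewrite mulrC.
have -> : \sum_a \sum_e gam L Hor Hor p a beta e
      * (can Hor Ver p e a c - gam L Hor Ver p e a c) =
    \sum_a \sum_e gam L Hor Hor p a beta e * can Hor Ver p e a c
    - \sum_a \sum_e gam L Hor Hor p a beta e * gam L Hor Ver p e a c.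
  by rewrite -sumrB; apply: eq_bigr => a _; exact: sum_mulB.
have -> : \sum_a \sum_e gam L Hor Hor p a beta e * gam L Hor Ver p e a c =
    \sum_a \sum_e gam L Hor Hor p e beta a * gam L Hor Ver p a e c.
  by rewrite exchange_big.
ring.
Qed.

Lemma natural_RicPV b nu p : A p -> RicPV L p b nu =
  (Ctr_cov L Ver Hor p b nu
   - \sum_d gam_cov L Ver Hor Ver p d b nu d)
  + \sum_d Ctr L Ver p d * gam L Ver Hor p d b nu
  - \sum_d \sum_e gam L Ver Ver p d b e * gam L Ver Hor p e d nu
  - \sum_d \sum_e gam L Ver Hor p d b e * can Hor Ver p e nu d
  - \sum_d \sum_e gam L Ver Ver p e b d * PT L p d nu e.
Proof.
move=> Ap; rewrite /RicPV.
under eq_bigr do rewrite natural_Pcurv//.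
rewrite sum_split6 gam_cov_trace//.
have -> : \sum_d Ctr L Ver p d * gam L Ver Hor p d b nu =
    \sum_d \sum_e gam L Ver Hor p e b nu * gam L Ver Ver p d e d.
  rewrite [RHS]exchange_big; apply: eq_bigr => e _.
  by rewrite Ctr_gam// mulr_suml; apply: eq_bigr => a _; rewrite mulrC.
rewrite [X in _ = _ - X - _ - _]exchange_big/=.
rewrite [X in _ = _ - _ - X]exchange_big/=.
ring.
Qed.

Lemma vbracketHH mu nu p d : vbracket L Hor mu Hor nu p d = - Rnl L p d nu mu.
Proof. by rewrite [RHS]opprB. Qed.

Lemma natural_RicR beta mu p : A p -> RicR L p beta mu =
  (\sum_a gam_cov L Hor Hor Hor p a beta mu a - Ctr_cov L Hor Hor p beta mu)
  - \sum_e Ctr L Hor p e * gam L Hor Hor p e beta mu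
  + \sum_a \sum_e gam L Hor Hor p a beta e * gam L Hor Hor p e mu a
  - \sum_a \sum_d gam L Hor Ver p a beta d * Rnl L p d a mu.
Proof.
move=> Ap; rewrite [LHS]natural_ricci//; congr (_ + _).
rewrite -sumrN; apply: eq_bigr => a _; rewrite -sumrN; apply: eq_bigr => d _.
by rewrite vbracketHH mulrN.
Qed.

Lemma natural_scalR p : A p -> scalR L p =
  2^-1 * (\sum_a \sum_mu Omegaup_cov L Hor Hor p a mu mu a
          - \sum_a \sum_mu Ctr L Hor p a * Omegaup L Hor p a mu mu)
  - \sum_mu Cup_cov L Hor Hor p mu mu
  + \sum_a \sum_mu \sum_e gamup L Hor Hor p a mu e * gam L Hor Hor p e mu a
  - \sum_a \sum_mu \sum_d gamup L Hor Ver p a mu d * Rnl L p d a mu.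
Proof.
move=> Ap; rewrite [LHS]natural_scalar//; congr (_ + _).
rewrite -sumrN; apply: eq_bigr => a _; rewrite -sumrN; apply: eq_bigr => mu _.
by rewrite -sumrN; apply: eq_bigr => d _; rewrite vbracketHH mulrN.
Qed.

Lemma natural_RicS b c p : A p -> RicS L p b c =
  (\sum_d gam_cov L Ver Ver Ver p d b c d - Ctr_cov L Ver Ver p b c)
  - \sum_d Ctr L Ver p d * gam L Ver Ver p d b c
  + \sum_d \sum_e gam L Ver Ver p d b e * gam L Ver Ver p e c d.
Proof.
move=> Ap; rewrite [LHS]natural_ricci// [X in _ + X = _]big1 ?addr0// => a _.
by rewrite big1// => d _; rewrite mulr0.
Qed.

Lemma natural_scalS p : A p -> scalS L p =
  2^-1 * (\sum_a \sum_d Omegaup_cov L Ver Ver p a d d a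
          - \sum_a \sum_d Ctr L Ver p a * Omegaup L Ver p a d d)
  - \sum_d Cup_cov L Ver Ver p d d
  + \sum_a \sum_d \sum_c gamup L Ver Ver p a d c * gam L Ver Ver p c d a.
Proof.
move=> Ap; rewrite [LHS]natural_scalar// [X in _ + X = _]big1 ?addr0// => a _.
by rewrite big1// => c _; rewrite big1// => d _; rewrite mulr0.
Qed.

End Contortion.

(** * Induced charts of an EAP-space satisfy the local hypotheses *)

Lemma open_tdom (R : realType) (n : nat) (M : manifold R n) (c0 : chart M) :
  open (tdom c0).
Proof.
rewrite (_ : tdom c0 = fst @^-1` (Defs.coord c0 @` dom c0)) //.
by apply: open_comp; [move=> p _; exact: cvg_fst|exact: coord_open].
Qed.

Lemma smooth_lam (R : realType) (n : nat) (M : manifold R n)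
    (E : EAP_space M) (c0 : chart M) k i a :
  smooth_on (tdom c0) (fun p => lam (EAP_local E c0) k i p a).
Proof.
have oA : open (tdom c0) by exact: open_tdom.
case: k; first exact: vcoef_smooth1.
apply: (smooth_add oA); first exact: vcoef_smooth2.
apply: (smooth_sum oA) => mu; apply: (smooth_mul oA).
  exact: Ncoef_smooth.
exact: vcoef_smooth1.
Qed.

Theorem theorem3p4 (R : realType) (n : nat) (M : manifold R n)
    (E : EAP_space M) (c0 : chart M) (p : tpoint R n) (hp : tdom c0 p) :
  let L := EAP_local E c0 in
  let C := coef (canonical_dconn L) Hor Ver p in
  let gHH := gam L Hor Hor p in   (* gamma^alpha_{mu nu} *)
  let gVH := gam L Ver Hor p in   (* gamma^a_{b mu} *)
  let gHV := gam L Hor Ver p in   (* gamma^alpha_{mu c} *)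
  let gVV := gam L Ver Ver p in   (* gamma^a_{b c} *)
  let Lam := LambdaT L p in
  let T := TT L p in
  let P := PT L p in
  let RN := Rnl L p in
  let CtH := Ctr L Hor p in
  let CtV := Ctr L Ver p in
  (* (a) *)
  (forall alpha beta mu nu : 'I_n,
    Rring L Hor p alpha beta mu nu =
      (gam_cov L Hor Hor Hor p alpha beta mu nu
       - gam_cov L Hor Hor Hor p alpha beta nu mu)
      + (\sum_e gHH e beta nu * gHH alpha e mu
         - \sum_e gHH e beta mu * gHH alpha e nu)
      - \sum_e gHH alpha beta e * Lam e nu mu
      - \sum_d gHV alpha beta d * RN d nu mu) /\
  (* (b) *)
  (forall a b mu nu : 'I_n,
    Rring L Ver p a b mu nu =
      (gam_cov L Ver Hor Hor p a b mu nu
       - gam_cov L Ver Hor Hor p a b nu mu)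
      + (\sum_d gVH d b nu * gVH a d mu - \sum_d gVH d b mu * gVH a d nu)
      - \sum_e gVH a b e * Lam e nu mu
      - \sum_d gVV a b d * RN d nu mu) /\
  (* (c) *)
  (forall alpha beta nu c : 'I_n,
    Pring L Hor p alpha beta nu c =
      (gam_cov L Hor Ver Hor p alpha beta c nu
       - gam_cov L Hor Hor Ver p alpha beta nu c)
      + (\sum_e gHH e beta nu * gHV alpha e c
         - \sum_e gHV e beta c * gHH alpha e nu)
      - \sum_e gHH alpha beta e * C e nu c
      - \sum_d gHV alpha beta d * P d nu c) /\
  (* (d) *)
  (forall a b nu c : 'I_n,
    Pring L Ver p a b nu c =
      (gam_cov L Ver Ver Hor p a b c nu
       - gam_cov L Ver Hor Ver p a b nu c)
      + (\sum_d gVH d b nu * gVV a d c - \sum_d gVV d b c * gVH a d nu)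
      - \sum_e gVH a b e * C e nu c
      - \sum_d gVV a b d * P d nu c) /\
  (* (e) *)
  (forall alpha beta b c : 'I_n,
    Sring L Hor p alpha beta b c =
      (gam_cov L Hor Ver Ver p alpha beta b c
       - gam_cov L Hor Ver Ver p alpha beta c b)
      + (\sum_e gHV e beta c * gHV alpha e b
         - \sum_e gHV e beta b * gHV alpha e c)
      - \sum_d gHV alpha beta d * T d c b) /\
  (* (f) *)
  (forall a b c d : 'I_n,
    Sring L Ver p a b c d =
      (gam_cov L Ver Ver Ver p a b c d
       - gam_cov L Ver Ver Ver p a b d c)
      + (\sum_e gVV e b d * gVV a e c - \sum_e gVV e b c * gVV a e d)
      - \sum_e gVV a b e * T e d c) /\
  (* (g) *)
  (forall beta mu : 'I_n,
    RicR L p beta mu =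
      (\sum_alpha gam_cov L Hor Hor Hor p alpha beta mu alpha
       - Ctr_cov L Hor Hor p beta mu)
      - \sum_e CtH e * gHH e beta mu
      + \sum_alpha \sum_e gHH alpha beta e * gHH e mu alpha
      - \sum_alpha \sum_d gHV alpha beta d * RN d alpha mu) /\
  (* (h) *)
  (scalR L p =
      2^-1 * (\sum_alpha \sum_mu Omegaup_cov L Hor Hor p alpha mu mu alpha
              - \sum_alpha \sum_mu CtH alpha * Omegaup L Hor p alpha mu mu)
      - \sum_mu Cup_cov L Hor Hor p mu mu
      + \sum_alpha \sum_mu \sum_e gamup L Hor Hor p alpha mu e * gHH e mu alpha
      - \sum_alpha \sum_mu \sum_d
          gamup L Hor Ver p alpha mu d * RN d alpha mu) /\
  (* (i) *)
  (forall beta c : 'I_n,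
    RicPH L p beta c =
      (Ctr_cov L Hor Ver p beta c
       - \sum_alpha gam_cov L Hor Ver Hor p alpha beta c alpha)
      + \sum_e CtH e * gHV e beta c
      + \sum_alpha \sum_e gHH alpha beta e * (C e alpha c - gHV e alpha c)
      + \sum_alpha \sum_d gHV alpha beta d * P d alpha c) /\
  (* (j) *)
  (forall b nu : 'I_n,
    RicPV L p b nu =
      (Ctr_cov L Ver Hor p b nu
       - \sum_d gam_cov L Ver Hor Ver p d b nu d)
      + \sum_d CtV d * gVH d b nu
      - \sum_d \sum_e gVV d b e * gVH e d nu
      - \sum_d \sum_e gVH d b e * C e nu d
      - \sum_d \sum_e gVV e b d * P d nu e) /\
  (* (k) *)
  (forall b c : 'I_n,
    RicS L p b c =
      (\sum_d gam_cov L Ver Ver Ver p d b c d - Ctr_cov L Ver Ver p b c)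
      - \sum_d CtV d * gVV d b c
      + \sum_d \sum_e gVV d b e * gVV e c d) /\
  (* (l) *)
  (scalS L p =
      2^-1 * (\sum_a \sum_d Omegaup_cov L Ver Ver p a d d a
              - \sum_a \sum_d CtV a * Omegaup L Ver p a d d)
      - \sum_d Cup_cov L Ver Ver p d d
      + \sum_a \sum_d \sum_c gamup L Ver Ver p a d c * gVV c d a).
Proof.
have oA : open (tdom c0) by exact: open_tdom.
have Nsm a mu : smooth_on (tdom c0) (fun q => Nloc (EAP_local E c0) q a mu).
  exact: Ncoef_smooth.
have Lsm := smooth_lam E c0.
have Lfree k q (qA : tdom c0 q) : row_free (lam_mx (EAP_local E c0) k q).
  exact: EAP_free.
move=> L C gHH gVH gHV gVV Lam T P RN CtH CtV.
do ? split.
- by move=> *; exact: (natural_Rcurv oA Nsm Lsm Lfree).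
- by move=> *; exact: (natural_Rcurv oA Nsm Lsm Lfree).
- by move=> *; exact: (natural_Pcurv oA Nsm Lsm Lfree).
- by move=> *; exact: (natural_Pcurv oA Nsm Lsm Lfree).
- by move=> *; exact: (natural_Scurv oA Nsm Lsm Lfree).
- by move=> *; exact: (natural_Scurv oA Nsm Lsm Lfree).
- by move=> *; exact: (natural_RicR oA Nsm Lsm Lfree).
- exact: (natural_scalR oA Nsm Lsm Lfree).
- by move=> *; exact: (natural_RicPH oA Nsm Lsm Lfree).
- by move=> *; exact: (natural_RicPV oA Nsm Lsm Lfree).
- by move=> *; exact: (natural_RicS oA Nsm Lsm Lfree).
- exact: (natural_scalS oA Nsm Lsm Lfree).
Qed.
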